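(* Consider three bodies of equal mass $m>0$ in the plane $\mathbb{R}^2$ and let $T>0$. If $x$ is a minimizer of the action $\mathcal{A}$ among $\mathbb{Z}/6\mathbb{Z}$-invariant loops of period $T$, then $x(t)$ is collision-free for every $t$. The same is true of a minimizer of $\mathcal{A}$ among $D_3$-invariant loops of period $T$.
   Context: Configurations are $x=(\vec r_0,\vec r_1,\vec r_2)\in(\mathbb{R}^2)^3$ with $\vec r_0+\vec r_1+\vec r_2=0$; a configuration is collision-free if the three positions are pairwise distinct. Loops of period $T$ are $T$-periodic paths $x(t)$ of configurations of Sobolev class $H^1_{\rm loc}$ (collisions allowed), with action $$\mathcal{A}(x)=\int_0^T\Big(\tfrac12\sum_i m\|\dot{\vec r}_i(t)\|^2+\sum_{i<j}\frac{m^2}{\|\vec r_i(t)-\vec r_j(t)\|}\Big)dt\in[0,+\infty].$$ The group $D_6=\langle s,\sigma\mid s^6=1,\ \sigma^2=1,\ s\sigma=\sigma s^{-1}\rangle$ acts on configurations by $\alpha$ and on time $\mathbb{R}/T\mathbb{Z}$ by $\beta$: $$\alpha(s)(\vec r_0,\vec r_1,\vec r_2)=(\Sigma\vec r_2,\Sigma\vec r_0,\Sigma\vec r_1),\quad \beta(s)(t)=t+T/6,$$ $$\alpha(\sigma)(\vec r_0,\vec r_1,\vec r_2)=(-\vec r_0,-\vec r_2,-\vec r_1),\quad \beta(\sigma)(t)=-t,$$ where $\Sigma$ is the orthogonal reflection of $\mathbb{R}^2$ with respect to a fixed line through the origin. A loop $x$ is invariant under a subgroup $G\subset D_6$ if $x(\beta(g)t)=\alpha(g)x(t)$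 for all $g\in G$ and all $t$. The subgroups considered are $\mathbb{Z}/6\mathbb{Z}=\langle s\rangle$ and $D_3=\langle s^2,\sigma\rangle$. A minimizer among $G$-invariant loops is a $G$-invariant loop of finite action which is minimal among all $G$-invariant loops of period $T$. *)

(* Defs.v *)
From HB Require Import structures.
From mathcomp Require Import all_boot all_order all_algebra all_fingroup.
From mathcomp Require Import ring.
From mathcomp Require Import all_classical all_reals all_analysis.

Set Implicit Arguments.
Unset Strict Implicit.
Unset Printing Implicit Defensive.

Import Order.TTheory GRing.Theory Num.Theory.

Local Open Scope classical_set_scope.
Local Open Scope ring_scope.

(* The dihedral group of order 12: Dihedral k e stands for s ^ k * sigma ^ e. *)
Record D6 : Type := Dihedral { rotation : 'Z_6; flip : bool }.

Definition D6_code (g : D6) : 'Z_6 * bool := (rotation g, flip g).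
Definition D6_decode (c : 'Z_6 * bool) : D6 := Dihedral c.1 c.2.
Lemma D6_codeK : cancel D6_code D6_decode. Proof. by case. Qed.

HB.instance Definition _ := Finite.copy D6 (can_type D6_codeK).

Definition D6_mul (g h : D6) : D6 :=
  Dihedral (if flip g then rotation g - rotation h else rotation g + rotation h)
           (flip g (+) flip h).

Definition D6_one : D6 := Dihedral 0 false.

Definition D6_inv (g : D6) : D6 :=
  Dihedral (if flip g then rotation g else - rotation g) (flip g).

Lemma D6_mulA : associative D6_mul.
Proof.
move=> [k []] [l []] [n f]; rewrite /D6_mul /= ?addbA; congr Dihedral.
all: by rewrite ?opprB ?opprD ?addrA ?negbK// addrAC.
Qed.

Lemma D6_mul1 : left_id D6_one D6_mul.
Proof. by move=> [k e]; rewrite /D6_mul /= add0r. Qed.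

Lemma D6_mulV : left_inverse D6_one D6_inv D6_mul.
Proof. by move=> [k []]; rewrite /D6_mul /= ?subrr ?addNr. Qed.

HB.instance Definition _ :=
  Finite_isGroup.Build D6 D6_mulA D6_mul1 D6_mulV.

Definition s : D6 := Dihedral 1 false.
Definition sigma : D6 := Dihedral 0 true.

Lemma D6_relations :
  [/\ (s ^+ 6 = 1)%g, (sigma ^+ 2 = 1)%g & (s * sigma = sigma * s^-1)%g].
Proof. by split; apply/eqP. Qed.

Lemma D6_normal_form (k : nat) (e : bool) :
  (s ^+ k * sigma ^+ e)%g = Dihedral k%:R e.
Proof.
have -> : (s ^+ k)%g = Dihedral k%:R false.
  by elim: k => [//|k IHk]; rewrite expgS IHk mulrSr addrC.
case: e; last by rewrite expg0 mulg1.
by congr Dihedral; exact: addr0.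
Qed.

Lemma card_D6 : #|[set: D6]%SET| = 12%N.
Proof.
have code_bij : bijective D6_code.
  by exists D6_decode; [exact: D6_codeK | case].
by rewrite cardsT (bij_eq_card code_bij) card_prod card_ord card_bool.
Qed.

Section Configurations.
Context {R : realType}.
Local Notation V := 'rV[R]_2.
Implicit Types (u v : V) (q : 'I_3 -> V).

Definition dotp u v : R := \sum_(k < 2) u 0 k * v 0 k.

(* The library's norm on matrices is the sup norm. *)
Definition enorm v : R := Num.sqrt (dotp v v).

(* Orthogonal reflection with respect to the line spanned by u != 0. *)
Definition reflection u v : V := (2 * dotp v u / dotp u u) *: u - v.

Definition centered q : Prop := \sum_i q i = 0.

Definition collision_free q : Prop := injective q.

(* Indices are taken modulo 3. *)
Definition alpha_s u q : 'I_3 -> V := fun i => reflection u (q (i - 1)).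
Definition alpha_sigma q : 'I_3 -> V := fun i => - q (- i).

Definition alpha u (g : D6) q : 'I_3 -> V :=
  iter (rotation g : nat) (alpha_s u) (if flip g then alpha_sigma q else q).

(* A lift to the real line of the action on R/TZ. *)
Definition beta (T : R) (g : D6) (t : R) : R :=
  (if flip g then - t else t) + (rotation g : nat)%:R * (T / 6).

Lemma alpha_sE u q :
  [/\ alpha u s q ord0 = reflection u (q (inord 2)),
      alpha u s q (inord 1) = reflection u (q ord0) &
      alpha u s q (inord 2) = reflection u (q (inord 1))].
Proof.
by split; congr (reflection u (q _)); apply/val_inj; rewrite /= ?inordK.
Qed.

Lemma alpha_sigmaE u q :
  [/\ alpha u sigma q ord0 = - q ord0,
      alpha u sigma q (inord 1) = - q (inord 2) &
      alpha u sigma q (inord 2) = - q (inord 1)].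
Proof. by split; congr (- q _); apply/val_inj; rewrite /= ?inordK. Qed.

Lemma reflectionK u : u != 0 -> involutive (reflection u).
Proof.
move=> u0 v; have uu0 : dotp u u != 0.
  apply: contraNN u0 => /eqP uu; apply/eqP/rowP => k; rewrite mxE.
  have /psumr_eq0P := uu => /(_ _) uk.
  by apply/eqP; rewrite -sqrf_eq0 expr2 uk// => i _; rewrite -expr2 sqr_ge0.
rewrite /reflection; apply/rowP => k; rewrite !mxE.
suff -> : dotp (2 * dotp v u / dotp u u *: u - v) u = dotp v u by ring.
transitivity (2 * dotp v u / dotp u u * dotp u u - dotp v u).
  by rewrite /dotp !big_ord_recr !big_ord0 /= !mxE; ring.
by rewrite divfK//; ring.
Qed.

Lemma alpha_s_order u q : u != 0 -> iter 6 (alpha_s u) q = q.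
Proof.
move=> u0; apply/funext => i; rewrite /= /alpha_s !reflectionK//.
by congr q; apply/val_inj; case: i => [[|[|[|]]]].
Qed.

Lemma alpha_sigmaK : involutive alpha_sigma.
Proof. by move=> q; apply/funext => i; rewrite /alpha_sigma !opprK. Qed.

Lemma alpha_s_sigma_s u q : u != 0 ->
  alpha_s u (alpha_sigma (alpha_s u q)) = alpha_sigma q.
Proof.
move=> u0; apply/funext => i; rewrite /alpha_s /alpha_sigma.
have reflN v : reflection u (- v) = - reflection u v.
  have dotN : dotp (- v) u = - dotp v u.
    by rewrite /dotp -sumrN; apply: eq_bigr => k _; rewrite mxE mulNr.
  by rewrite /reflection dotN mulrN mulNr scaleNr opprB opprK addrC.
by rewrite reflN reflectionK// opprB addrAC subrr sub0r.
Qed.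

Lemma alphaM u g h q : u != 0 ->
  alpha u (g * h)%g q = alpha u g (alpha u h q).
Proof.
move=> u0.
have iter_mod n p : iter (n %% 6) (alpha_s u) p = iter n (alpha_s u) p.
  rewrite {2}(divn_eq n 6) addnC iterD; congr iter.
  by elim: (n %/ 6)%N => // k IHk; rewrite mulSn iterD -IHk alpha_s_order.
have swap n p :
    iter n (alpha_s u) (alpha_sigma (iter n (alpha_s u) p)) = alpha_sigma p.
  elim: n p => // n IHn p.
  by rewrite iterSr [iter n.+1 _ p]iterS alpha_s_sigma_s.
case: g h => [k e] [l f]; rewrite /alpha /=; case: e => /=; last first.
  by rewrite iter_mod iterD.
set p := if f then _ else _.
have -> : (if ~~ f then alpha_sigma q else q) = alpha_sigma p.
  by rewrite /p; case: (f); rewrite ?alpha_sigmaK.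
rewrite -(swap l p) -iterD -iter_mod.
by rewrite -[in RHS](subrK l k).
Qed.

Lemma betaM (T : R) g h (t : R) :
  exists n : int, beta T (g * h)%g t = beta T g (beta T h t) + n%:~R * T.
Proof.
case: g h => [k e] [l f]; rewrite /beta.
set t' := if flip (Dihedral l f) then _ else _.
have -> : (if flip (Dihedral k e * Dihedral l f)%g then - t else t) =
          if e then - t' else t'.
  by rewrite /t' /=; case: e; case: (f); rewrite /= ?opprK.
case: e => /=.
  pose n := ((k - l : 'Z_6)%R + l)%N.
  exists (n %/ 6)%N%:Z.
  have kE : (k : nat) = (n %% 6)%N by rewrite -[in LHS](subrK l k).
  have : n%:R = (n %/ 6)%:R * 6 + (k : nat)%:R :> R.
    by rewrite {1}(divn_eq n 6) natrD natrM kE.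
  rewrite /n natrD => /(canRL (addrK _)) ->.
  by rewrite -/n; field.
exists (- (((k + l) %/ 6)%N%:Z)).
have : (k + l)%:R = ((k + l) %/ 6)%:R * 6 + ((k + l) %% 6)%:R :> R.
  by rewrite {1}(divn_eq (k + l) 6) natrD natrM.
rewrite natrD => /(canLR (addKr _)) <-.
by rewrite mulrNz; field.
Qed.

End Configurations.

Section Loops.
Context {R : realType}.
Local Notation V := 'rV[R]_2.
Local Notation mu := (@lebesgue_measure R).
Implicit Types (m T : R) (u : V) (f v : R -> R) (x : R -> 'I_3 -> V).

(* f is a primitive of the locally square integrable function v, i.e., f is the
   continuous representative of an H^1_loc function with weak derivative v. *)
Definition weak_derivative f v : Prop :=
  [/\ measurable_fun setT v,
      forall a b, (\int[mu]_(t in `[a, b]) ((v t) ^+ 2)%:E < +oo)%E &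
      forall a b, a <= b -> f b - f a = \int[mu]_(t in `[a, b]) v t].

Definition H1loc f : Prop := exists v, weak_derivative f v.

(* Weak derivatives are unique almost everywhere: integrals involving wderiv f
   do not depend on the choice made here. *)
Definition wderiv f : R -> R := xget (cst 0) [set v | weak_derivative f v].

Definition coordinate x (i : 'I_3) (k : 'I_2) : R -> R := fun t => x t i 0 k.

Definition velocity x (i : 'I_3) (t : R) : V :=
  \row_k wderiv (coordinate x i k) t.

Definition loop T x : Prop :=
  [/\ forall t, x (t + T) = x t,
      forall t, centered (x t) &
      forall i k, H1loc (coordinate x i k)].

Definition pair_potential m (r : V) : \bar R :=
  if r == 0 then +oo%E else (m ^+ 2 / enorm r)%:E.

Definition lagrangian m x (t : R) : \bar R :=
  ((2^-1 * \sum_i m * enorm (velocity x i t) ^+ 2)%:E +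
   \sum_(i < 3) \sum_(j < 3 | (i < j)%N) pair_potential m (x t i - x t j)%R)%E.

Definition lagrangian_action m T x : \bar R :=
  (\int[mu]_(t in `[0%R, T]) lagrangian m x t)%E.

Definition invariant_under u T (G : {set D6}) x : Prop :=
  forall g, g \in G -> forall t, x (beta T g t) = alpha u g (x t).

Definition invariant_loop u T (G : {set D6}) x : Prop :=
  loop T x /\ invariant_under u T G x.

Definition minimizer u m T (G : {set D6}) x : Prop :=
  [/\ invariant_loop u T G x,
      (lagrangian_action m T x < +oo)%E &
      forall y, invariant_loop u T G y ->
        (lagrangian_action m T x <= lagrangian_action m T y)%E].

End Loops.

(* Main.v *)
Require Import Defs.
From mathcomp Require Import all_boot all_order all_algebra all_fingroup.
From mathcomp Require Import ring lra.
From mathcomp Require Import all_classical all_reals all_analysis.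
From mathcomp Require Import measurable_realfun.

Set Implicit Arguments.
Unset Strict Implicit.
Unset Printing Implicit Defensive.

Import Order.TTheory GRing.Theory Num.Theory.
Import numFieldNormedType.Exports.

Local Open Scope classical_set_scope.
Local Open Scope ring_scope.

(** The proof compares action levels. Write l for the length with
    l^3 = m T^2 and X = m l^2 / T for the resulting unit of action. An explicit
    collision-free figure eight, invariant under the whole of D_6, has action
    below (69/5) X (eight_action), while an invariant loop with a collision has
    action at least (69/5) X (cyclic_loop_action, dihedral_loop_action). So a
    minimizer for either subgroup has no collision.

    Lower bound. Since 3 sum |v_i|^2 = sum |v_i - v_j|^2 + |sum v_i|^2, the
    Lagrangian dominates the sum over the three sides rho = r_i - r_(i+1) of
    the Kepler Lagrangian (m/6) |rho'|^2 + m^2 / |rho| (lagrangian_sides), and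
    the symmetry carries a collision of one pair to collisions of all three.
    An arc of a Kepler path is bounded below by convex duality: for a
    decreasing momentum P, Young's inequality gives both
    (m/6) |rho'|^2 >= P |rho'| - (3/2m) P^2 and
    m^2 / |rho| >= 2 m sqrt(-P') + P' |rho|, and integrating by parts leaves
    only the values of |rho| at the ends (arc_action_piece, for affine P). Four
    affine pieces give the cost 2.02 s X of an arc of duration s^3 T that
    starts at a collision (departure_arc_scaled), against an optimal constant
    of about 2.23 that is attained by the ejection orbit reaching its apex at
    the final time.

    For Z/6Z, s^3 maps each pair to itself and shifts time by T/2, so every
    side vanishes twice per period, and four arcs of duration T/4 suffice
    (period_of_collisions). For D_3, the side r_1 - r_2 is even about every
    time c in (T/2) Z, so it vanishes at c + d T and c - d T for some c and
    some d in [0, 1/4]. When d is not small, the collision arcs suffice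
    (collision_far_from_euler). When d is small the two collisions are close
    to each other, but the configuration at time c is an Euler configuration:
    r_0 = 0 and r_1 = - r_2. With eta = |r_1 (c)|, the side has length 2 eta at
    c and eta at c + T/3 and c - T/3. Hence reaching a collision from
    2 eta within the time d T is expensive if eta is large, and c is close to a
    triple collision if eta is small; a suitable choice of momenta makes the
    two effects cancel exactly, and the bound holds for every eta
    (collision_near_euler).

    Upper bound. On the figure eight the three phases theta differ by a third
    of a turn, so the sums of cos (2 theta) and of cos (4 theta) over the bodies
    vanish. Hence the kinetic energy is constant; and the inverse distances have
    majorants that are quadratic in cos (2 theta) (inverse_distance_majorant), so
    that the Lagrangian is below a constant at almost every time
    (eight_lagrangian). *)

(** * Change of variables and weak derivatives *)

Section ChangeOfVariable.
Context {R : realType}.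
Local Notation mu := (@lebesgue_measure R).

Lemma lebesgue_measureD (c : R) (A : set R) : measurable A ->
  pushforward mu ((fun t => t + c) : _ -> measurableTypeR R) A = mu A.
Proof.
have mf : measurable_fun [set: measurableTypeR R] ((fun t => t + c) : measurableTypeR R -> measurableTypeR R).
  exact: measurable_funD.
move=> mA; apply/esym/lebesgue_measure_unique => //= _ [[a b]] _ <-.
rewrite /pushforward.
have -> : (fun t => t + c) @^-1` [set` `]a, b]] = `]a - c, b - c]%classic.
  by apply/seteqP; split => t /=; rewrite !in_itv/= ltrBlDr lerBrDr.
by rewrite !lebesgue_measure_itv/= !lte_fin ltrD2r; case: ifP => // _; congr EFin; ring.
Qed.

Lemma integral_translate (c a b : R) (f : R -> \bar R) :
  measurable_fun setT f ->
  (\int[mu]_(t in `[a, b]) f (t + c)%R = \int[mu]_(t in `[(a + c)%R, (b + c)%R]) f t)%E.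
Proof.
have mf : measurable_fun [set: measurableTypeR R] ((fun t => t + c) : measurableTypeR R -> measurableTypeR R).
  exact: measurable_funD.
have E : `[a, b]%classic = (fun t => t + c) @^-1` `[a + c, b + c].
  by apply/seteqP; split => t /=; rewrite !in_itv/= !lerD2r.
have ge0 (g : R -> \bar R) : measurable_fun setT g -> (forall t, (0 <= g t)%E) ->
   (\int[mu]_(t in `[a, b]) g (t + c)%R = \int[mu]_(t in `[(a + c)%R, (b + c)%R]) g t)%E.
  move=> mg g0; rewrite [in LHS]E -(ge0_integral_pushforward mf)//=.
    by apply: eq_measure_integral => A mA _; exact: lebesgue_measureD.
  exact: measurable_funTS.
move=> mg; rewrite integralE [RHS]integralE; congr (_ - _)%E.
  by rewrite -(ge0 (f^\+)%E)//; [by apply: eq_integral => t _; rewrite ?funeposE ?funenegE|exact: measurable_funepos].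
by rewrite -(ge0 (f^\-)%E)//; [by apply: eq_integral => t _; rewrite ?funeposE ?funenegE|exact: measurable_funeneg].
Qed.

Lemma integral_oppr (a b : R) (f : R -> \bar R) :
  measurable_fun setT f ->
  (\int[mu]_(t in `[a, b]) f (- t)%R = \int[mu]_(t in `[(- b)%R, (- a)%R]) f t)%E.
Proof.
have mf : measurable_fun [set: measurableTypeR R] (-%R : measurableTypeR R -> measurableTypeR R).
  exact: oppr_measurable.
have E : `[a, b]%classic = -%R @^-1` `[- b, - a].
  by rewrite opp_preimage_itvbndbnd/= !opprK.
have ge0 (g : R -> \bar R) : measurable_fun setT g -> (forall t, (0 <= g t)%E) ->
   (\int[mu]_(t in `[a, b]) g (- t)%R = \int[mu]_(t in `[(- b)%R, (- a)%R]) g t)%E.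
  move=> mg g0; rewrite [in LHS]E -(ge0_integral_pushforward mf)//=.
    by apply: eq_measure_integral => A mA _; exact: lebesgue_measureN.
  exact: measurable_funTS.
move=> mg; rewrite integralE [RHS]integralE; congr (_ - _)%E.
  by rewrite -(ge0 (f^\+)%E)//; [by apply: eq_integral => t _; rewrite ?funeposE ?funenegE|exact: measurable_funepos].
by rewrite -(ge0 (f^\-)%E)//; [by apply: eq_integral => t _; rewrite ?funeposE ?funenegE|exact: measurable_funeneg].
Qed.

Lemma integral_reflect (c a b : R) (f : R -> \bar R) :
  measurable_fun setT f ->
  (\int[mu]_(t in `[a, b]) f (c - t)%R = \int[mu]_(t in `[(c - b)%R, (c - a)%R]) f t)%E.
Proof.
move=> mf; have mg : measurable_fun setT (fun t : R => f (t + c)).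
  by apply: measurableT_comp => //; exact: measurable_funD.
under eq_integral do rewrite addrC.
by rewrite (integral_oppr _ _ mg) integral_translate// ![- _ + c]addrC.
Qed.

Lemma ge0_integral_itv_cat (a b c : R) (f : R -> \bar R) :
  measurable_fun setT f -> (forall t, (0 <= f t)%E) -> a <= b -> b <= c ->
  (\int[mu]_(t in `[a, c]) f t =
   \int[mu]_(t in `[a, b]) f t + \int[mu]_(t in `[b, c]) f t)%E.
Proof.
move=> mf f0 ab bc.
rewrite -(@integral_itv_obnd_cbnd _ b); last exact: measurable_funTS.
rewrite -ge0_integral_setU//=.
- by rewrite (@itv_bndbnd_setU _ _ (BLeft a) (BRight b) (BRight c)).
- exact: measurable_funTS.
- apply/disj_setPS => t [] /=; rewrite !in_itv/= => /andP[_ tb] /andP[bt _].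
  by move: (lt_le_trans bt tb); rewrite ltxx.
Qed.

End ChangeOfVariable.

Section WeakDerivative.
Context {R : realType}.
Local Notation mu := (@lebesgue_measure R).
Implicit Types (f g v w : R -> R).

Lemma sqr_integrable v a b : measurable_fun setT v ->
  (\int[mu]_(t in `[a, b]) ((v t) ^+ 2)%:E < +oo)%E ->
  mu.-integrable `[a, b] (EFin \o v).
Proof.
move=> mv v2.
have mv2 : measurable_fun setT (fun t => v t ^+ 2) by exact: measurable_funX.
have i2 : mu.-integrable `[a, b] (EFin \o (fun t => 1 + v t ^+ 2)).
  have i1 : mu.-integrable `[a, b] (EFin \o (cst 1 : R -> R)).
    apply: measurable_bounded_integrable => //.
    - by rewrite /= lebesgue_measure_itv /=; case: ifP => // _; rewrite -EFinB ltry.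
    - exact: bounded_cst.
  suff : mu.-integrable `[a, b] (EFin \o (fun t => v t ^+ 2)).
    by move=> i3; exact: (integrableD _ i1 i3).
  apply/integrableP; split; first exact/measurable_EFinP/measurable_funTS.
  apply: le_lt_trans v2; apply: ge0_le_integral => //=.
  - by apply/measurable_EFinP/measurable_funTS/measurableT_comp.
  - exact/measurable_EFinP/measurable_funTS.
  - by move=> t _; rewrite lee_fin ger0_norm// sqr_ge0.
apply: le_integrable i2 => //; first exact/measurable_EFinP/measurable_funTS.
move=> t _ /=; rewrite lee_fin [leRHS]ger0_norm; last first.
  by rewrite addr_ge0// sqr_ge0.
have := sqr_ge0 (`|v t| - 1); have := sqr_ge0 (v t).
by rewrite -(real_normK (num_real (v t))); nra.
Qed.

Lemma weak_derivative_integrable f v a b : weak_derivative f v ->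
  mu.-integrable `[a, b] (EFin \o v).
Proof. by move=> [mv v2 _]; exact: sqr_integrable. Qed.

Lemma weak_derivative_continuous f v : weak_derivative f v -> continuous f.
Proof.
move=> fv t.
have itv := @weak_derivative_integrable f v (t - 1) (t + 1) fv.
have ab : t - 1 < t + 1 by lra.
have [_ _ ftc] := fv.
have c := parameterized_integral_continuous (ltW ab) itv.
have tin : t \in `](t - 1), (t + 1)[ by rewrite in_itv/=; apply/andP; split; lra.
have ct := within_continuous_continuous ab c tin.
pose g y := f (t - 1) + parameterized_integral mu (t - 1) y v.
have cg : {for t, continuous g} by apply: cvgD => //; exact: cvg_cst.
have gE : \forall y \near t, g y = f y.
  apply: filterS (near_in_itvoo tin) => y; rewrite in_itv/= => /andP[/ltW ty _].
  by rewrite /g /parameterized_integral -ftc// addrC subrK.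
rewrite /continuous_at -(nbhs_singleton gE).
by apply: cvg_trans cg; exact: near_eq_cvg.
Qed.

Lemma weak_derivative_measurable f v : weak_derivative f v ->
  measurable_fun setT f.
Proof. by move=> fv; apply: continuous_measurable_fun; exact: weak_derivative_continuous fv. Qed.

Lemma weak_derivative_sub f g v w :
  weak_derivative f v -> weak_derivative g w ->
  weak_derivative (fun t => f t - g t) (fun t => v t - w t).
Proof.
move=> fv gw; have [mv v2 fE] := fv; have [mw w2 gE] := gw.
have mvw : measurable_fun setT (fun t => v t - w t) by exact: measurable_funB.
have mX (h : R -> R) D : measurable_fun setT h ->
    measurable_fun D (fun t => (h t ^+ 2)%:E).
  by move=> mh; apply/measurable_EFinP/measurable_funTS/measurable_funX.
split=> // [a b|a b ab].
  have : (\int[mu]_(t in `[a, b]) ((2 * v t ^+ 2)%:E + (2 * w t ^+ 2)%:E) < +oo)%E.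
    rewrite ge0_integralD//=.
    - under eq_integral do rewrite EFinM.
      under [X in (_ + X)%E]eq_integral do rewrite EFinM.
      rewrite !ge0_integralZl_EFin ?lte_add_pinfty//.
      + by rewrite lte_mul_pinfty.
      + by rewrite lte_mul_pinfty.
      + by move=> t _; rewrite lee_fin sqr_ge0.
      + exact: mX.
      + by move=> t _; rewrite lee_fin sqr_ge0.
      + exact: mX.
    - by move=> t _; rewrite lee_fin mulr_ge0// sqr_ge0.
    - apply/measurable_EFinP/measurable_funM => //; exact/measurable_funTS/measurable_funX.
    - by move=> t _; rewrite lee_fin mulr_ge0// sqr_ge0.
    - apply/measurable_EFinP/measurable_funM => //; exact/measurable_funTS/measurable_funX.
  apply: le_lt_trans; apply: ge0_le_integral => //=.
  - by move=> t _; rewrite lee_fin sqr_ge0.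
  - exact: mX.
  - apply/measurable_EFinP/measurable_funD; apply/measurable_funM => //; exact/measurable_funTS/measurable_funX.
  - move=> t _; rewrite lee_fin; have := sqr_ge0 (v t + w t); lra.
rewrite RintegralB//; [|exact: weak_derivative_integrable fv|exact: weak_derivative_integrable gw].
by rewrite -fE// -gE//; ring.
Qed.

Lemma weak_derivative_translate f v c : weak_derivative f v ->
  weak_derivative (fun t : R => f (t + c)) (fun t => v (t + c)).
Proof.
move=> [mv v2 fE]; have mc : measurable_fun setT (fun t : R => t + c).
  exact: measurable_funD.
split=> [|a b|a b ab]; first exact: measurableT_comp.
  rewrite (integral_translate c a b (f := fun t => (v t ^+ 2)%:E))//.
  exact/measurable_EFinP/measurable_funX.
rewrite /Rintegral (integral_translate c a b (f := fun t => (v t)%:E)).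
  by rewrite fE// lerD2r.
exact/measurable_EFinP.
Qed.

Lemma weak_derivative_reflect f v c : weak_derivative f v ->
  weak_derivative (fun t => f (c - t)) (fun t => - v (c - t)).
Proof.
move=> fv; have [mv v2 fE] := fv.
have mc : measurable_fun setT (fun t : R => c - t) by exact: measurable_funB.
have mvc : measurable_fun setT (fun t : R => v (c - t)) by exact: measurableT_comp.
have v2c a b : (\int[mu]_(t in `[a, b]) ((v (c - t)) ^+ 2)%:E < +oo)%E.
  rewrite (integral_reflect c a b (f := fun t => (v t ^+ 2)%:E))//.
  exact/measurable_EFinP/measurable_funX.
split=> [|a b|a b ab]; first exact/measurable_funN.
  by under eq_integral do rewrite sqrrN.
under eq_Rintegral do rewrite -mulN1r.
rewrite RintegralZl//; last by exact: sqr_integrable.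
rewrite /Rintegral (integral_reflect c a b (f := fun t => (v t)%:E)); last first.
  exact/measurable_EFinP.
by rewrite -[fine _]/(\int[mu]_(t in _) v t) -fE ?lerB//; ring.
Qed.

(** The difference of two weak derivatives has a vanishing primitive, and
    Lebesgue's differentiation theorem recovers it from that primitive almost
    everywhere. *)
Lemma weak_derivative_unique f v w a : weak_derivative f v ->
  weak_derivative f w -> {ae mu, forall t, a < t -> v t = w t}.
Proof.
move=> fv fw; have := weak_derivative_sub fv fw.
set h := fun t => v t - w t; move=> fh; have [mh h2 hE] := fh.
have li : locally_integrable [set: R] h.
  split=> //; first exact: openT.
  move=> K _ cK.
  have [M [_ MK]] := compact_bounded cK.
  pose N := `|M| + 1.
  have KN : K `<=` `[- N, N].
    move=> t Kt /=; rewrite in_itv/= -ler_norml; apply: (MK N) => //.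
    by rewrite (le_lt_trans (ler_norm M))// ltrDl.
  have /integrableP[_ ] := weak_derivative_integrable (- N) N fh.
  apply: le_lt_trans; apply: ge0_subset_integral => //.
  - exact: compact_measurable.
  - by apply/measurable_EFinP/measurable_funTS; exact: measurableT_comp.
have ih (y : R) : mu.-integrable [set` Interval (BLeft a) (BRight y)] (EFin \o h).
  exact: weak_derivative_integrable fh.
have F0 : (fun y => \int[mu]_(t in [set` Interval (BLeft a) (BRight y)]) h t) = cst 0.
  apply/funext => y; have [ay|ya] := leP a y; first by rewrite -hE// !subrr.
  by rewrite set_itv_ge ?Rintegral_set0// bnd_simp -ltNge.
have := FTC1 ih li; rewrite /= F0.
apply: filterS; first exact: (ae_filter_ringOfSetsType mu).
move=> t Ft at_; have [|_] := Ft; first by rewrite lte_fin.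
by rewrite derive1_cst => /esym/eqP; rewrite subr_eq0 => /eqP.
Qed.

End WeakDerivative.

(** * Planar paths and their length *)

Section PlanarPath.
Context {R : realType}.
Local Notation V := 'rV[R]_2.
Local Notation mu := (@lebesgue_measure R).
Implicit Types (u v : V) (q w : R -> V) (m : R).

Lemma dotpE u v : dotp u v = u 0 ord0 * v 0 ord0 + u 0 ord_max * v 0 ord_max.
Proof.
rewrite /dotp big_ord_recr big_ord1/=.
by have -> : widen_ord (leqnSn 1) ord0 = ord0 by exact: val_inj.
Qed.

Lemma dotp_ge0 u : 0 <= dotp u u.
Proof. by rewrite dotpE -!expr2 addr_ge0// sqr_ge0. Qed.

Lemma enorm_ge0 u : 0 <= enorm u. Proof. exact: sqrtr_ge0. Qed.

Lemma sqr_enorm u : enorm u ^+ 2 = dotp u u.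
Proof. by rewrite sqr_sqrtr// dotp_ge0. Qed.

Lemma enorm_eq0 u : (enorm u == 0) = (u == 0).
Proof.
apply/eqP/eqP => [|->]; last by rewrite /enorm dotpE !mxE mul0r addr0 sqrtr0.
move=> u0; have := sqr_enorm u; rewrite u0 expr0n/= dotpE -!expr2 => /esym/eqP.
rewrite paddr_eq0 ?sqr_ge0// !sqrf_eq0 => /andP[/eqP u1 /eqP u2].
apply/rowP => -[[|[|//]] i]; rewrite mxE; [rewrite -u1|rewrite -u2]; congr (u 0 _); exact: val_inj.
Qed.

Lemma enormN u : enorm (- u) = enorm u.
Proof. by congr Num.sqrt; rewrite !dotpE !mxE; ring. Qed.

Lemma dotp_le_enorm u v : dotp u v <= enorm u * enorm v.
Proof.
have := enorm_ge0 u; have := enorm_ge0 v => v0 u0.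
rewrite leNgt; apply/negP => /[dup] uv; rewrite -ltr_sqr ?nnegrE ?mulr_ge0//; last first.
  by rewrite (le_trans _ (ltW uv))// mulr_ge0.
rewrite exprMn !sqr_enorm !dotpE; set a := u _ _; set b := u _ _; set c := v _ _; set d := v _ _.
have := sqr_ge0 (a * d - b * c); nra.
Qed.

Lemma enormD u v : enorm (u + v) <= enorm u + enorm v.
Proof.
have := enorm_ge0 u; have := enorm_ge0 v => v0 u0.
rewrite -ler_sqr ?nnegrE ?addr_ge0 ?enorm_ge0// sqrrD !sqr_enorm.
have -> : dotp (u + v) (u + v) = dotp u u + 2 * dotp u v + dotp v v.
  by rewrite !dotpE !mxE; ring.
have := dotp_le_enorm u v; rewrite mulr2n; lra.
Qed.

(** The velocity is a parameter because it is determined only almost everywhere: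
    translates and differences of paths come with natural representatives. *)
Definition path_velocity q w :=
  forall k, weak_derivative (fun t => q t 0 k) (fun t => w t 0 k).

Lemma path_velocity_sub q1 w1 q2 w2 : path_velocity q1 w1 -> path_velocity q2 w2 ->
  path_velocity (fun t => q1 t - q2 t) (fun t => w1 t - w2 t).
Proof.
move=> h1 h2 k; have := weak_derivative_sub (h1 k) (h2 k).
by congr weak_derivative; apply/funext => t; rewrite !mxE.
Qed.

Lemma path_velocity_translate q w c : path_velocity q w ->
  path_velocity (fun t => q (t + c)) (fun t => w (t + c)).
Proof. by move=> qw k; exact: weak_derivative_translate (qw k). Qed.

Lemma path_velocity_reflect q w c : path_velocity q w ->
  path_velocity (fun t => q (c - t)) (fun t => - w (c - t)).
Proof.
move=> qw k; have := weak_derivative_reflect c (qw k).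
by congr weak_derivative; apply/funext => t; rewrite !mxE.
Qed.

Lemma path_velocity_measurable q w : path_velocity q w ->
  measurable_fun setT (fun t => dotp (q t) (q t)) /\
  measurable_fun setT (fun t => dotp (w t) (w t)).
Proof.
move=> qw; have mq k := weak_derivative_measurable (qw k).
have mw k : measurable_fun setT (fun t => w t 0 k) by have [] := qw k.
split.
  by under eq_fun do rewrite dotpE; apply: measurable_funD; exact: measurable_funM.
by under eq_fun do rewrite dotpE; apply: measurable_funD; exact: measurable_funM.
Qed.

Lemma measurable_sqrt : measurable_fun setT (@Num.sqrt R).
Proof. apply: continuous_measurable_fun; exact: sqrt_continuous. Qed.

Lemma speed_measurable q w : path_velocity q w ->
  measurable_fun setT (fun t => enorm (w t)).
Proof.
by move=> /path_velocity_measurable[_ mw]; exact: measurableT_comp measurable_sqrt mw.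
Qed.

Lemma speed_integrable q w a b : path_velocity q w ->
  mu.-integrable `[a, b] (EFin \o (fun t => enorm (w t))).
Proof.
move=> qw; apply: sqr_integrable; first exact: speed_measurable qw.
under eq_integral do rewrite sqr_enorm dotpE EFinD -!expr2.
have [m0 i0 _] := qw ord0; have [m1 i1 _] := qw ord_max.
rewrite ge0_integralD//=.
- by rewrite lte_add_pinfty.
- by move=> t _; rewrite lee_fin sqr_ge0.
- exact/measurable_EFinP/measurable_funTS/measurable_funX.
- by move=> t _; rewrite lee_fin sqr_ge0.
- exact/measurable_EFinP/measurable_funTS/measurable_funX.
Qed.

Lemma speed_Rintegral q w a b : path_velocity q w ->
  (\int[mu]_(t in `[a, b]) (enorm (w t))%:E)%E =
  (\int[mu]_(t in `[a, b]) enorm (w t))%:E.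
Proof.
move=> qw; rewrite fineK//; apply: integrable_fin_num => //.
exact: speed_integrable qw.
Qed.

(** Projecting on the direction of the displacement reduces the triangle
    inequality for the integral of the velocity to the scalar one. *)
Lemma displacement_le q w a b : path_velocity q w -> a <= b ->
  enorm (q b - q a) <= \int[mu]_(t in `[a, b]) enorm (w t).
Proof.
move=> qw ab; set z := q b - q a; set n := enorm z.
have [->|n0] := eqVneq n 0.
  by apply: Rintegral_ge0 => t _; exact: enorm_ge0.
have n_gt0 : 0 < n by rewrite lt_neqAle eq_sym n0 enorm_ge0.
rewrite -(ler_pM2l n_gt0) -expr2 sqr_enorm dotpE.
have zk k : z 0 k = \int[mu]_(t in `[a, b]) w t 0 k.
  by have [_ _ <-//] := qw k; rewrite !mxE.
have iw k := weak_derivative_integrable a b (qw k).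
have iwZ k : mu.-integrable `[a, b] (EFin \o (fun t => z 0 k * w t 0 k)).
  exact: (integrableZl _ (z 0 k) (iw k)).
rewrite {2}(zk ord0) {2}(zk ord_max) -!RintegralZl//; last exact: speed_integrable qw.
rewrite -RintegralD//.
apply: le_Rintegral => //.
- exact: (integrableD _ (iwZ _) (iwZ _)).
- exact: (integrableZl _ n (speed_integrable a b qw)).
- by move=> t _; rewrite -dotpE; exact: dotp_le_enorm.
Qed.

(** Tonelli on the triangle a <= s <= t <= b. *)
Lemma integral_triangle (f : R -> R) a b : measurable_fun setT f ->
  (forall t, 0 <= f t) ->
  (\int[mu]_(t in `[a, b]) \int[mu]_(s in `[a, t]) (f s)%:E =
   \int[mu]_(s in `[a, b]) ((b - s) * f s)%:E)%E.
Proof.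
move=> mf f0.
pose h (z : R * R) : \bar R :=
  if [&& a <= z.2, z.2 <= z.1 & z.1 <= b] then (f z.2)%:E else 0%E.
have mh : measurable_fun setT h.
  apply: measurable_fun_ifT => //.
    apply: measurable_and; first exact: measurable_fun_ler.
    by apply: measurable_and; exact: measurable_fun_ler.
  by apply/measurable_EFinP; exact: measurableT_comp mf _.
have h0 z : (0 <= h z)%E by rewrite /h; case: ifP => // _; rewrite lee_fin.
have H := @fubini_tonelli _ _ _ _ _ mu mu h mh h0.
rewrite integral_mkcond [in RHS]integral_mkcond.
transitivity (\int[mu]_x \int[mu]_y h (x, y))%E; last rewrite H.
  apply: eq_integral => t _; rewrite patchE; case: ifPn => tab.
    rewrite integral_mkcond; apply: eq_integral => s _; rewrite patchE /h/=.
    move: tab; rewrite inE/= in_itv/= => /andP[_ tb].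
    have -> : (s \in `[a, t]%classic) = (a <= s <= t) by rewrite mem_setE in_itv.
    by rewrite tb andbT.
  rewrite integral0_eq// => s _; rewrite /h/=; case: ifPn => // /and3P[sa st tb].
  by move/negP: tab; rewrite inE/= in_itv/= tb (le_trans sa st).
apply: eq_integral => s _; rewrite patchE; case: ifPn => sab.
  move: sab; rewrite inE/= in_itv/= => /andP[sa sb].
  transitivity (\int[mu]_(t in `[s, b]) (f s)%:E)%E.
    rewrite [RHS]integral_mkcond; apply: eq_integral => t _; rewrite patchE /h/=.
    have -> : (t \in `[s, b]%classic) = (s <= t <= b) by rewrite mem_setE in_itv.
    by rewrite sa.
  rewrite integral_cst//= lebesgue_measure_itv/= lte_fin.
  case: ltP => [_|bs]; first by rewrite -EFinB -EFinM mulrC.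
  by rewrite mule0 (le_anti (introT andP (conj sb bs))) subrr mul0r.
rewrite integral0_eq// => t _; rewrite /h/=; case: ifPn => // /and3P[sa st tb].
by move/negP: sab; rewrite inE/= in_itv/= sa (le_trans st tb).
Qed.

Lemma integral_sqr_affine (P k a b : R) : a <= b ->
  (\int[mu]_(t in `[a, b]) ((P + k * (b - t)) ^+ 2)%:E =
   ((b - a) * ((P + k * (b - a)) ^+ 2 + (P + k * (b - a)) * P + P ^+ 2) / 3)%:E)%E.
Proof.
rewrite le_eqVlt => /orP[/eqP<-|ab].
  by rewrite set_itv1 integral_set1 subrr !mul0r.
pose F (t : R) : R := - (P ^+ 2 * (b - t) + P * k * (b - t) ^+ 2 + k ^+ 2 / 3 * (b - t) ^+ 3).
have dF (t : R) : is_derive t (1 : R) F ((P + k * (b - t)) ^+ 2).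
  rewrite /F; apply: is_derive_eq.
  by rewrite /GRing.scale/=; field.
rewrite (@continuous_FTC2 _ _ F)//.
- by rewrite -EFinB; congr EFin; rewrite /F; field.
- apply: continuous_subspaceT => t.
  apply: differentiable_continuous; apply/derivable1_diffP.
  exact: ex_derive.
- have cF : continuous F.
    move=> t; apply/differentiable_continuous/derivable1_diffP.
    exact: ex_derive.
  split=> [t _||].
  + exact: ex_derive.
  + exact: cvg_at_right_filter (cF a).
  + exact: cvg_at_left_filter (cF b).
- by move=> t _; rewrite derive1E derive_val.
Qed.

End PlanarPath.

(** * Duality bound for an arc of a Kepler path *)

Section KeplerArc.
Context {R : realType}.
Local Notation V := 'rV[R]_2.
Local Notation mu := (@lebesgue_measure R).
Implicit Types (q w : R -> V) (m : R).

(** The share of the three-body Lagrangian that belongs to one side q; the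
    coefficient m/6 comes from Leibniz's identity. *)
Definition kepler m q w (t : R) : \bar R :=
  ((m / 6 * enorm (w t) ^+ 2)%:E + pair_potential m (q t))%E.

Definition arc_action m q w (a b : R) : \bar R :=
  (\int[mu]_(t in `[a, b]) kepler m q w t)%E.

Lemma pair_potential_ge0 m r : (0 <= pair_potential m r)%E.
Proof.
rewrite /pair_potential; case: ifP => // _.
by rewrite lee_fin divr_ge0 ?sqr_ge0 ?enorm_ge0.
Qed.

Lemma kepler_ge0 m q w t : 0 < m -> (0 <= kepler m q w t)%E.
Proof.
move=> m0; rewrite adde_ge0 ?pair_potential_ge0// lee_fin.
by rewrite mulr_ge0 ?sqr_ge0// divr_ge0// ltW.
Qed.

Lemma pair_potential_measurable m q w : path_velocity q w ->
  measurable_fun setT (fun t => pair_potential m (q t)).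
Proof.
move=> qw.
have mq : measurable_fun setT (fun t => enorm (q t)).
  by have [mq _] := path_velocity_measurable qw; exact: measurableT_comp measurable_sqrt mq.
apply: measurable_fun_ifT => //.
  by under eq_fun do rewrite -enorm_eq0; exact: measurable_fun_eqr.
have powE t : m ^+ 2 / enorm (q t) = m ^+ 2 * enorm (q t) `^ (-1).
  by rewrite powR_inv1// enorm_ge0.
apply/measurable_EFinP; under eq_fun do rewrite powE.
by apply: measurable_funM => //; exact: measurableT_comp (measurable_powR _) mq.
Qed.

Lemma kepler_measurable m q w : path_velocity q w ->
  measurable_fun setT (kepler m q w).
Proof.
move=> qw; apply: emeasurable_funD; last exact: pair_potential_measurable qw.
by apply/measurable_EFinP/measurable_funM => //; apply: measurable_funX; exact: speed_measurable qw.
Qed.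

Lemma arc_action_cat m q w a b c : 0 < m -> path_velocity q w ->
  a <= b -> b <= c ->
  arc_action m q w a c = (arc_action m q w a b + arc_action m q w b c)%E.
Proof.
move=> m0 qw; apply: ge0_integral_itv_cat; first exact: kepler_measurable.
by move=> t; exact: kepler_ge0.
Qed.

Lemma arc_action_ge0 m q w a b : 0 < m -> (0 <= arc_action m q w a b)%E.
Proof. by move=> m0; apply: integral_ge0 => t _; exact: kepler_ge0. Qed.

Lemma arc_action_reflect m q w c a b : path_velocity q w ->
  arc_action m (fun t => q (c - t)) (fun t => - w (c - t)) a b =
  arc_action m q w (c - b) (c - a).
Proof.
move=> qw; rewrite /arc_action -(integral_reflect c a b) ?opprB//; last first.
  exact: kepler_measurable.
by apply: eq_integral => t _; rewrite /kepler enormN.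
Qed.

(** Two completions of squares: P is the momentum dual to the speed, and g^2 is
    the force dual to the distance. *)
Lemma kepler_young m q w (t g P r : R) : 0 < m -> 0 <= g -> enorm (q t) <= r ->
  ((2 * m * g + P * enorm (w t))%:E <=
   kepler m q w t + (g ^+ 2 * r + 3 / (2 * m) * P ^+ 2)%:E)%E.
Proof.
move=> m0 g0 qr; rewrite /kepler /pair_potential.
have [_|q0] := eqVneq (q t) 0; first by rewrite addeC addeA addey// leey.
rewrite -!EFinD lee_fin; set v := enorm (w t); set e := enorm (q t).
have e0 : 0 < e by rewrite lt_neqAle eq_sym enorm_eq0 q0 enorm_ge0.
have kin : P * v <= m / 6 * v ^+ 2 + 3 / (2 * m) * P ^+ 2.
  rewrite -subr_ge0.
  have -> : m / 6 * v ^+ 2 + 3 / (2 * m) * P ^+ 2 - P * v =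
    (m * v - 3 * P) ^+ 2 / (6 * m) by field; rewrite gt_eqF.
  by rewrite divr_ge0 ?sqr_ge0// mulr_ge0// ltW.
have pot : 2 * m * g <= m ^+ 2 / e + g ^+ 2 * e.
  rewrite -subr_ge0.
  have -> : m ^+ 2 / e + g ^+ 2 * e - 2 * m * g = (m - g * e) ^+ 2 / e.
    by field; rewrite gt_eqF.
  by rewrite divr_ge0 ?sqr_ge0// ltW.
have : g ^+ 2 * e <= g ^+ 2 * r by rewrite ler_wpM2l// sqr_ge0.
lra.
Qed.

(** The inequality kepler_young along the affine momentum P + g^2 (b - t).
    The distance at time t is at most A plus the length travelled since a; after
    exchanging the order of integration, the contributions of the length cancel
    except at the ends, where they give P B - P0 A, with B equal to A plus the
    total length. When consecutive pieces share the momentum at their common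
    end, these boundary terms telescope. *)
Lemma arc_action_piece m q w (a b A g P : R) : 0 < m -> path_velocity q w ->
  a <= b -> 0 <= g -> 0 <= P -> enorm (q a) <= A ->
  let P0 := P + g ^+ 2 * (b - a) in
  exists2 B, enorm (q b) <= B &
  ((2 * m * g * (b - a) - (b - a) * (P0 ^+ 2 + P0 * P + P ^+ 2) / (2 * m)
    + P * B - P0 * A)%:E <= arc_action m q w a b)%E.
Proof.
move=> m0 qw ab g0 P_ge0 qA P0.
pose v t := enorm (w t).
pose I t := \int[mu]_(s in `[a, t]) v s.
pose S := I b.
have bound t : a <= t -> enorm (q t) <= A + I t.
  move=> at_; have -> : q t = q a + (q t - q a) by rewrite addrC subrK.
  by rewrite (le_trans (enormD _ _))// lerD// displacement_le.
exists (A + S); first exact: bound.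
have mv : measurable_fun setT v by exact: speed_measurable qw.
have v0 t : 0 <= v t by exact: enorm_ge0.
have IE t : (\int[mu]_(s in `[a, t]) (v s)%:E)%E = (I t)%:E.
  exact: speed_Rintegral qw.
have I0 t : 0 <= I t by apply: Rintegral_ge0.
have mI : measurable_fun setT I.
  apply: nondecreasing_measurable => // s t st.
  rewrite -lee_fin -!IE; apply: ge0_subset_integral => //=.
  - exact/measurable_EFinP/measurable_funTS.
  - by move=> ? _; rewrite lee_fin.
  - by apply: subset_itvl; rewrite bnd_simp.
pose bv (s : R) := (b - s) * v s.
have mb : measurable_fun setT (fun s : R => b - s) by exact: measurable_funB.
have mbv : measurable_fun setT bv by exact: measurable_funM.
have bv0 s : s \in `[a, b] -> 0 <= bv s.
  by rewrite in_itv/= => /andP[_ sb]; rewrite mulr_ge0// subr_ge0.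
pose M := \int[mu]_(s in `[a, b]) bv s.
have ME : (\int[mu]_(s in `[a, b]) (bv s)%:E)%E = M%:E.
  rewrite fineK//; apply: integrable_fin_num => //.
  have : mu.-integrable `[a, b] (fun t => (b - a)%:E * (v t)%:E)%E.
    exact: (integrableZl _ (b - a) (speed_integrable a b qw)).
  apply: le_integrable => //; first exact/measurable_EFinP/measurable_funTS.
  move=> s sab; rewrite lee_fin ger0_norm ?bv0// ger0_norm ?mulr_ge0 ?subr_ge0//.
  by move: sab; rewrite /= in_itv/= => /andP[sa _]; rewrite ler_wpM2r// lerB.
(* The force g^2 times the integral of I cancels the affine part of the momentum
   times the speed: both equal g^2 M. *)
have IM : (\int[mu]_(t in `[a, b]) (I t)%:E)%E = M%:E.
  rewrite -ME -integral_triangle//; apply: eq_integral => t _.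
  by rewrite IE.
pose k := g ^+ 2.
have k0 : 0 <= k by exact: sqr_ge0.
pose lo t := 2 * m * g + (P * v t + k * bv t).
pose hi t := (k * A + k * I t) + 3 / (2 * m) * (P + k * (b - t)) ^+ 2.
have A0 : 0 <= A by rewrite (le_trans _ qA)// enorm_ge0.
have c0 : 0 <= 3 / (2 * m) by rewrite divr_ge0// mulr_ge0// ltW.
have mP : measurable_fun setT (fun t : R => (P + k * (b - t)) ^+ 2).
  by apply/measurable_funX/measurable_funD => //; exact: measurable_funM.
have mD (f : R -> R) : measurable_fun setT f -> measurable_fun `[a, b] (EFin \o f).
  by move=> mf; exact/measurable_EFinP/measurable_funTS.
have mZ (c : R) (f : R -> R) : measurable_fun setT f ->
    measurable_fun setT (fun t => c * f t).
  by move=> mf; exact: measurable_funM.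
have cst_int (c : R) : (\int[mu]_(t in `[a, b]) c%:E = (c * (b - a))%:E)%E.
  rewrite integral_cst//= lebesgue_measure_itv/= lte_fin.
  case: ltP => [_|ba]; first by rewrite -EFinB -EFinM.
  by rewrite mule0 (le_anti (introT andP (conj ab ba))) subrr mulr0.
have intD (f h : R -> R) : measurable_fun setT f -> measurable_fun setT h ->
    (forall t, t \in `[a, b] -> 0 <= f t) -> (forall t, t \in `[a, b] -> 0 <= h t) ->
    (\int[mu]_(t in `[a, b]) (f t + h t)%:E =
     \int[mu]_(t in `[a, b]) (f t)%:E + \int[mu]_(t in `[a, b]) (h t)%:E)%E.
  move=> mf mh f0 h0; under eq_integral do rewrite EFinD.
  by rewrite ge0_integralD//; try exact: mD; move=> t tab; rewrite lee_fin ?f0 ?h0.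
have intZ (c : R) (f : R -> R) : measurable_fun setT f -> 0 <= c ->
    (forall t, t \in `[a, b] -> 0 <= f t) ->
    (\int[mu]_(t in `[a, b]) (c * f t)%:E =
     c%:E * \int[mu]_(t in `[a, b]) (f t)%:E)%E.
  move=> mf c_ge0 f0; under eq_integral do rewrite EFinM.
  by rewrite ge0_integralZl_EFin//; try exact: mD; move=> t tab; rewrite lee_fin f0.
have mg0 : 0 <= 2 * m * g by rewrite !mulr_ge0// ltW.
have lo0 t : t \in `[a, b] -> 0 <= lo t.
  by move=> tab; rewrite !addr_ge0 ?mg0 ?(mulr_ge0 P_ge0) ?(mulr_ge0 k0) ?bv0.
have hi0 t : 0 <= hi t.
  by rewrite !addr_ge0 ?(mulr_ge0 k0) ?(mulr_ge0 c0) ?sqr_ge0.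
have mlo : measurable_fun setT lo.
  by apply: measurable_funD => //; apply: measurable_funD; exact: mZ.
have mhi : measurable_fun setT hi.
  apply: measurable_funD; last exact: mZ.
  by apply: measurable_funD => //; exact: mZ.
have loE : (\int[mu]_(t in `[a, b]) (lo t)%:E =
    (2 * m * g * (b - a) + (P * S + k * M))%:E)%E.
  rewrite intD//.
  - rewrite cst_int intD//.
    + by rewrite !intZ// IE ME.
    + exact: mZ.
    + exact: mZ.
    + by move=> t _; rewrite mulr_ge0.
    + by move=> t tab; rewrite mulr_ge0// bv0.
  - by apply: measurable_funD; exact: mZ.
  - by move=> t tab; rewrite addr_ge0 ?(mulr_ge0 P_ge0) ?(mulr_ge0 k0) ?bv0.
have hiE : (\int[mu]_(t in `[a, b]) (hi t)%:E = (k * A * (b - a) + k * M +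
   3 / (2 * m) * ((b - a) * (P0 ^+ 2 + P0 * P + P ^+ 2) / 3))%:E)%E.
  rewrite intD//.
  - rewrite intD//.
    + by rewrite cst_int !intZ ?IM ?integral_sqr_affine// => t _; rewrite sqr_ge0.
    + exact: mZ.
    + by move=> t _; rewrite mulr_ge0.
    + by move=> t _; rewrite mulr_ge0.
  - by apply: measurable_funD => //; exact: mZ.
  - exact: mZ.
  - by move=> t _; rewrite addr_ge0 ?(mulr_ge0 k0).
  - by move=> t _; rewrite mulr_ge0 ?sqr_ge0.
have : (\int[mu]_(t in `[a, b]) (lo t)%:E <=
  \int[mu]_(t in `[a, b]) (kepler m q w t + (hi t)%:E))%E.
  apply: ge0_le_integral => //.
  - exact: mD.
  - apply/measurable_funTS/emeasurable_funD; first exact: kepler_measurable qw.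
    exact/measurable_EFinP.
  - move=> t /=; rewrite in_itv/= => /andP[ta tb].
    have -> : lo t = 2 * m * g + (P + k * (b - t)) * v t by rewrite /lo /bv; ring.
    have -> : hi t = g ^+ 2 * (A + I t) + 3 / (2 * m) * (P + k * (b - t)) ^+ 2.
      by rewrite /hi /k; ring.
    by apply: kepler_young => //; exact: bound.
rewrite ge0_integralD//=.
- rewrite loE hiE -leeBlDr// -EFinB; apply: le_trans; rewrite lee_fin le_eqVlt.
  apply/orP; left; apply/eqP; rewrite /P0 -/k; field; rewrite gt_eqF//.
- by move=> t _; exact: kepler_ge0.
- by apply: measurable_funTS; exact: kepler_measurable qw.
- by move=> t _; rewrite lee_fin.
- exact: mD.
Qed.

End KeplerArc.

(** * Arcs that start or end at a collision *)

Section CollisionArcs.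
Context {R : realType}.
Local Notation V := 'rV[R]_2.
Implicit Types (q w : R -> V) (m : R).

Lemma cube_root (x : R) : 0 <= x -> exists2 s, 0 <= s & s ^+ 3 = x.
Proof.
move=> x0; exists (x `^ 3^-1); first exact: powR_ge0.
by rewrite -powR_mulrn ?powR_ge0// -powRrM mulVf ?powRr1.
Qed.

Lemma arc_action_cat_le m q w a b c (x y : R) : 0 < m -> path_velocity q w ->
  a <= b -> b <= c -> (x%:E <= arc_action m q w a b)%E ->
  (y%:E <= arc_action m q w b c)%E -> ((x + y)%:E <= arc_action m q w a c)%E.
Proof.
by move=> m0 qw ab bc hx hy; rewrite (arc_action_cat m0 qw ab bc) EFinD leeD.
Qed.

Lemma arc_action_reverse m q w a b : path_velocity q w ->
  arc_action m (fun t => q (a + b - t)) (fun t => - w (a + b - t)) a b =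
  arc_action m q w a b.
Proof. by move=> qw; rewrite arc_action_reflect// addrK addrAC subrr add0r. Qed.

(** The previous bound in the units m l^2 / T of action and l^4 / T^3 of momentum,
    in which the coefficients are pure numbers. *)
Lemma arc_action_piece_scaled m q w (l T a tau kappa p A : R) : 0 < m -> 0 < l -> 0 < T ->
  l ^+ 3 = m * T ^+ 2 -> path_velocity q w ->
  0 <= tau -> 0 <= kappa -> 0 <= p -> enorm (q a) <= A ->
  let p0 := p + kappa ^+ 2 * tau in
  exists2 B, enorm (q (a + tau * T)) <= B &
  (((2 * kappa * tau - tau * (p0 ^+ 2 + p0 * p + p ^+ 2) / 2) * (m * l ^+ 2 / T)
    + l ^+ 4 / T ^+ 3 * (p * B - p0 * A))%:E
    <= arc_action m q w a (a + tau * T))%E.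
Proof.
move=> m0 l0 T0 lT qw tau0 k0 p_ge0 qA p0.
have Y0 : 0 < l ^+ 4 / T ^+ 3 by rewrite divr_gt0// exprn_gt0.
have ab : a <= a + tau * T by rewrite lerDl mulr_ge0// ltW.
have g0 : 0 <= kappa * (l ^+ 2 / T ^+ 2).
  by rewrite mulr_ge0// divr_ge0// exprn_ge0// ltW.
have P0 : 0 <= p * (l ^+ 4 / T ^+ 3) by rewrite mulr_ge0// ltW.
have [B qB HB] := arc_action_piece m0 qw ab g0 P0 qA.
exists B => //; apply: le_trans HB; rewrite lee_fin le_eqVlt; apply/orP; left.
have mE : m = l ^+ 3 / T ^+ 2 by rewrite lT mulfK// expf_neq0// gt_eqF.
apply/eqP; rewrite /p0 mE; field.
by rewrite !gt_eqF.
Qed.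

(** The momentum of the ejection orbit with apex at time T blows up like the power
    -1/3 of the time since the collision. It is approximated by four affine
    pieces with ends at T/500, T/40, 7T/40 and T; the slopes are the squares of
    50, 8, 9/4 and 7/8. The initial distance is 0 and the final momentum is 0, so
    no boundary term remains. *)
Lemma collision_arc m q w (l T a : R) : 0 < m -> 0 < l -> 0 < T ->
  l ^+ 3 = m * T ^+ 2 -> path_velocity q w -> q a = 0 ->
  ((101 / 50 * (m * l ^+ 2 / T))%:E <= arc_action m q w a (a + T))%E.
Proof.
move=> m0 l0 T0 lT qw qa.
pose k1 : R := 50; pose k2 : R := 8; pose k3 : R := 9 / 4; pose k4 : R := 7 / 8.
pose t1 : R := 1 / 500; pose t2 : R := 1 / 40 - 1 / 500.
pose t3 : R := 7 / 40 - 1 / 40; pose t4 : R := 1 - 7 / 40.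
pose p3 := k4 ^+ 2 * t4; pose p2 := p3 + k3 ^+ 2 * t3; pose p1 := p2 + k2 ^+ 2 * t2.
have [k1_ge0 k2_ge0 k3_ge0 k4_ge0] : [/\ 0 <= k1, 0 <= k2, 0 <= k3 & 0 <= k4].
  by rewrite /k1 /k2 /k3 /k4; split; lra.
have [t1_ge0 t2_ge0 t3_ge0 t4_ge0] : [/\ 0 <= t1, 0 <= t2, 0 <= t3 & 0 <= t4].
  by rewrite /t1 /t2 /t3 /t4; split; lra.
have p3_ge0 : 0 <= p3 by rewrite mulr_ge0 ?sqr_ge0.
have p2_ge0 : 0 <= p2 by rewrite addr_ge0 ?mulr_ge0 ?sqr_ge0.
have p1_ge0 : 0 <= p1 by rewrite addr_ge0 ?mulr_ge0 ?sqr_ge0.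
have qa0 : enorm (q a) <= 0 by rewrite qa le_eqVlt enorm_eq0 eqxx.
have [B1 q1 H1] := arc_action_piece_scaled m0 l0 T0 lT qw t1_ge0 k1_ge0 p1_ge0 qa0.
have [B2 q2 H2] := arc_action_piece_scaled m0 l0 T0 lT qw t2_ge0 k2_ge0 p2_ge0 q1.
have [B3 q3 H3] := arc_action_piece_scaled m0 l0 T0 lT qw t3_ge0 k3_ge0 p3_ge0 q2.
have [B4 q4 H4] := arc_action_piece_scaled m0 l0 T0 lT qw t4_ge0 k4_ge0 (lexx 0) q3.
have le_step x t : 0 <= t -> x <= x + t * T.
  by move=> t0; rewrite lerDl mulr_ge0// ltW.
have H12 := arc_action_cat_le m0 qw (le_step _ _ t1_ge0) (le_step _ _ t2_ge0) H1 H2.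
have H34 := arc_action_cat_le m0 qw (le_step _ _ t3_ge0) (le_step _ _ t4_ge0) H3 H4.
have := arc_action_cat_le m0 qw _ _ H12 H34.
have -> : a + t1 * T + t2 * T + t3 * T + t4 * T = a + T.
  by rewrite /t1 /t2 /t3 /t4; field.
move=> H; apply: le_trans (H _ _); last 2 first.
- by rewrite (le_trans (le_step _ _ t1_ge0))// le_step.
- have -> : a + T = a + t1 * T + t2 * T + t3 * T + t4 * T.
    by rewrite /t1 /t2 /t3 /t4; field.
  by rewrite (le_trans (le_step _ _ t3_ge0))// le_step.
rewrite lee_fin; set X := m * _ / _; set Y := l ^+ 4 / _.
have X0 : 0 < X by rewrite divr_gt0// mulr_gt0// exprn_gt0.
clear H1 H2 H3 H4 H12 H34 H.
rewrite -subr_ge0 /p1 /p2 /p3 /k1 /k2 /k3 /k4 /t1 /t2 /t3 /t4.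
lra.
Qed.

End CollisionArcs.

(** * Kepler paths with collisions over one period *)

Section HalfPeriod.
Context {R : realType}.
Local Notation V := 'rV[R]_2.
Variables (m l T : R).
Hypotheses (m0 : 0 < m) (l0 : 0 < l) (T0 : 0 < T) (lT : l ^+ 3 = m * T ^+ 2).
Implicit Types (q w : R -> V).
Local Notation X := (m * l ^+ 2 / T).

Let X0 : 0 < X. Proof. by rewrite divr_gt0// mulr_gt0// exprn_gt0. Qed.

(** Kepler's scaling: a duration multiplied by s^3 multiplies lengths by s^2 and
    actions by s. *)
Lemma departure_arc_scaled q w a s : path_velocity q w -> 0 <= s -> q a = 0 ->
  ((101 / 50 * s * X)%:E <= arc_action m q w a (a + s ^+ 3 * T))%E.
Proof.
move=> qw; rewrite le_eqVlt => /orP[/eqP<- _|s0 qa].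
  by rewrite mulr0 mul0r arc_action_ge0.
have ls0 : 0 < l * s ^+ 2 by rewrite mulr_gt0// exprn_gt0.
have sT0 : 0 < s ^+ 3 * T by rewrite mulr_gt0// exprn_gt0.
have lsT : (l * s ^+ 2) ^+ 3 = m * (s ^+ 3 * T) ^+ 2.
  by rewrite !exprMn lT; ring.
apply: le_trans (collision_arc m0 ls0 sT0 lsT qw qa).
rewrite lee_fin le_eqVlt; apply/orP; left; apply/eqP; field.
by rewrite !gt_eqF.
Qed.

Lemma arrival_arc_scaled q w a b s : path_velocity q w -> 0 <= s -> q b = 0 ->
  b = a + s ^+ 3 * T ->
  ((101 / 50 * s * X)%:E <= arc_action m q w a b)%E.
Proof.
move=> qw s0 qb bE; rewrite -(arc_action_reverse m a b qw) bE.
by apply: departure_arc_scaled => //; [exact: path_velocity_reflect|rewrite -bE addrAC subrr add0r].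
Qed.

Lemma consecutive_collisions q w c : path_velocity q w ->
  q c = 0 -> q (c + T / 2) = 0 ->
  ((23 / 10 * X)%:E <= arc_action m q w c (c + T / 2))%E.
Proof.
move=> qw qc qT; have [s s0 sE] := @cube_root R (1 / 4) ltac:(lra).
have s_ge : 3 / 5 <= s.
  rewrite leNgt; apply/negP => s_lt.
  have : s ^+ 3 < (3 / 5) ^+ 3 by rewrite ltrXn2r//; lra.
  by rewrite sE; lra.
have bE : c + T / 2 = c + s ^+ 3 * T + s ^+ 3 * T by rewrite sE; field.
have cs : c <= c + s ^+ 3 * T by rewrite lerDl mulr_ge0 ?exprn_ge0// ltW.
have := arc_action_cat_le m0 qw cs _ (departure_arc_scaled qw s0 qc)
  (arrival_arc_scaled qw s0 qT bE).
move=> H; apply: le_trans (H _); last by rewrite bE lerDl mulr_ge0 ?exprn_ge0// ltW.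
rewrite lee_fin -mulrDl ler_wpM2r ?(ltW X0)//; lra.
Qed.

(** With cube roots s of d and r of 1/2 - d, the bound is proportional to s + r,
    which at fixed s^3 + r^3 is smallest when s and r are most unequal, that is,
    for d = 7/100. *)
Lemma collision_far_from_euler q w c d : path_velocity q w -> 7 / 100 <= d <= 1 / 4 ->
  q (c + d * T) = 0 ->
  ((23 / 10 * X)%:E <= arc_action m q w c (c + T / 2))%E.
Proof.
move=> qw /andP[d1 d2] qd.
have [s s0 sE] := @cube_root R d ltac:(lra).
have [r r0 rE] := @cube_root R (1 / 2 - d) ltac:(lra).
have bE : c + T / 2 = c + d * T + r ^+ 3 * T by rewrite rE; field.
have cs : c <= c + d * T by rewrite lerDl mulr_ge0 ?(ltW T0)//; lra.
have sc : c + d * T <= c + T / 2 by rewrite bE lerDl mulr_ge0 ?exprn_ge0// ltW.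
have dE : c + d * T = c + s ^+ 3 * T by rewrite sE.
have H2 := departure_arc_scaled qw r0 qd; rewrite -bE in H2.
have := arc_action_cat_le m0 qw cs sc (arrival_arc_scaled qw s0 qd dE) H2.
apply: le_trans; rewrite lee_fin -mulrDl ler_wpM2r ?(ltW X0)//.
have s_ge : 41 / 100 <= s.
  rewrite leNgt; apply/negP => s_lt.
  have : s ^+ 3 < (41 / 100) ^+ 3 by rewrite ltrXn2r//; lra.
  by rewrite sE; lra.
have sr : s <= r.
  by rewrite -(@ler_pXn2r _ 3)// sE rE; lra.
have : 114 / 100 <= s + r.
  rewrite leNgt; apply/negP => sr_lt.
  have sum : s ^+ 3 + r ^+ 3 = 1 / 2 by rewrite sE rE; field.
  have : r ^+ 3 < (114 / 100 - s) ^+ 3 by rewrite ltrXn2r//; lra.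
  have : 0 <= (s - 41 / 100) * (114 / 100 - 41 / 100 - s) by rewrite mulr_ge0//; lra.
  nra.
lra.
Qed.

(** The half period is cut at the collision and at T/6, T/3 after c. The bound
    for an arc of duration T/6 that starts at distance at most eta is the bound for
    a collision arc minus the initial momentum p times eta, and there are two such
    arcs, on both sides of c + T/3. Going from distance 2 eta at c to the collision with
    constant momentum p gives back 2 p eta, so eta disappears; what remains is a
    loss of (3/2) p^2 d, harmless for d <= 7/100. *)
Lemma collision_near_euler q w c d eta : path_velocity q w -> 0 <= d <= 7 / 100 ->
  q (c + d * T) = 0 -> 2 * eta <= enorm (q c) -> enorm (q (c + T / 3)) <= eta ->
  ((23 / 10 * X)%:E <= arc_action m q w c (c + T / 2))%E.
Proof.
move=> qw /andP[d0 d1] qd qc qT.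
pose Y := l ^+ 4 / T ^+ 3.
have Y0 : 0 < Y by rewrite divr_gt0// exprn_gt0.
(* kappa ^ 2 is the slope of the momentum on the two arcs of duration T / 6; the
   value 14 / 5 nearly maximizes the final bound for d close to 7 / 100 *)
pose kappa : R := 14 / 5; pose p : R := kappa ^+ 2 / 6.
have k0 : 0 <= kappa by rewrite /kappa; lra.
have p0 : 0 <= p by rewrite /p divr_ge0 ?sqr_ge0.
have [s s0 sE] := @cube_root R (1 / 6 - d) ltac:(lra).
have s_ge : 45 / 100 <= s.
  rewrite leNgt; apply/negP => s_lt.
  have : s ^+ 3 < (45 / 100) ^+ 3 by rewrite ltrXn2r//; lra.
  by rewrite sE; lra.
have c_le : c <= c + d * T by rewrite lerDl mulr_ge0// ltW.
have cE : c + d * T + s ^+ 3 * T = c + T / 6 by rewrite sE; field.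
have cd_le : c + d * T <= c + T / 6.
  by rewrite -cE lerDl mulr_ge0 ?exprn_ge0// ltW.
have [c6 c3] : c + T / 6 <= c + T / 3 /\ c + T / 3 <= c + T / 2 by split; lra.
have sixth : 0 <= 1 / 6 :> R by lra.
(* The arc is run backwards, so that its initial distance is 0 and its final
   distance is that of time c. *)
have H1 : (((- (3 / 2) * p ^+ 2 * d) * X + Y * (2 * p * eta))%:E <=
    arc_action m q w c (c + d * T))%E.
  rewrite -(arc_action_reverse m c (c + d * T) qw).
  have q'w := path_velocity_reflect (c + (c + d * T)) qw.
  have q'0 : enorm (q (c + (c + d * T) - c)) <= 0.
    by rewrite addrAC subrr add0r qd le_eqVlt enorm_eq0 eqxx.
  have [B qB HB] := arc_action_piece_scaled m0 l0 T0 lT q'w d0 (lexx 0) p0 q'0.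
  apply: le_trans HB; rewrite lee_fin.
  have etaB : 2 * eta <= B.
    by apply: le_trans qB; rewrite addrK.
  have : 0 <= Y * p * (B - 2 * eta) by rewrite mulr_ge0 ?subr_ge0// mulr_ge0// ltW.
  rewrite -/Y; lra.
have H2 := departure_arc_scaled qw s0 qd; rewrite cE in H2.
have bounded_start q' w' a : path_velocity q' w' -> enorm (q' a) <= eta ->
    (((kappa / 3 - p ^+ 2 / 12) * X - Y * (p * eta))%:E <=
     arc_action m q' w' a (a + T / 6))%E.
  move=> q'w' q'a.
  have [B _ HB] := arc_action_piece_scaled m0 l0 T0 lT q'w' sixth k0 (lexx 0) q'a.
  have -> : a + T / 6 = a + 1 / 6 * T by field.
  apply: le_trans HB; rewrite lee_fin -/Y /p; lra.
have H3 : (((kappa / 3 - p ^+ 2 / 12) * X - Y * (p * eta))%:E <=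
     arc_action m q w (c + T / 6) (c + T / 3))%E.
  rewrite -(arc_action_reverse m _ _ qw).
  have -> : c + T / 3 = c + T / 6 + T / 6 by field.
  apply: bounded_start; first exact: path_velocity_reflect.
  apply: le_trans qT; rewrite le_eqVlt; apply/orP; left; apply/eqP; congr (enorm (q _)).
  by field.
have H4 : (((kappa / 3 - p ^+ 2 / 12) * X - Y * (p * eta))%:E <=
     arc_action m q w (c + T / 3) (c + T / 2))%E.
  have -> : c + T / 2 = c + T / 3 + T / 6 by field.
  exact: bounded_start.
have H12 := arc_action_cat_le m0 qw c_le cd_le H1 H2.
have H34 := arc_action_cat_le m0 qw c6 c3 H3 H4.
have := arc_action_cat_le m0 qw (le_trans c_le cd_le) (le_trans c6 c3) H12 H34.
apply: le_trans; rewrite lee_fin.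
have -> : - (3 / 2) * p ^+ 2 * d * X + Y * (2 * p * eta) + 101 / 50 * s * X +
  ((kappa / 3 - p ^+ 2 / 12) * X - Y * (p * eta) + ((kappa / 3 - p ^+ 2 / 12) * X - Y * (p * eta)))
  = (- (3 / 2) * p ^+ 2 * d + 101 / 50 * s + 2 * (kappa / 3 - p ^+ 2 / 12)) * X by ring.
rewrite ler_wpM2r ?(ltW X0)//.
(* In terms of s, the bound is increasing. *)
have dE : d = 1 / 6 - s ^+ 3 by rewrite sE; ring.
have s3 : (45 / 100) ^+ 3 <= s ^+ 3 by rewrite lerXn2r// ?nnegrE//; lra.
rewrite dE /p /kappa; lra.
Qed.

Lemma period_of_collisions q w c : path_velocity q w ->
  q c = 0 -> q (c + T / 2) = 0 -> q (c + T) = 0 ->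
  ((23 / 5 * X)%:E <= arc_action m q w c (c + T))%E.
Proof.
move=> qw q0 q1 q2.
have [h1 h2] : c <= c + T / 2 /\ c + T / 2 <= c + T by move: T0; split; lra.
have E : c + T = c + T / 2 + T / 2 by field.
have H1 := consecutive_collisions qw q0 q1.
have H2 := consecutive_collisions qw q1 (etrans (congr1 q (esym E)) q2).
rewrite -E in H2.
apply: le_trans (arc_action_cat_le m0 qw h1 h2 H1 H2).
by rewrite lee_fin le_eqVlt; apply/orP; left; apply/eqP; field; rewrite gt_eqF.
Qed.

Lemma half_period_from_euler q w c d eta : path_velocity q w ->
  0 <= d <= 1 / 4 -> q (c + d * T) = 0 ->
  2 * eta <= enorm (q c) -> enorm (q (c + T / 3)) <= eta ->
  ((23 / 10 * X)%:E <= arc_action m q w c (c + T / 2))%E.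
Proof.
move=> qw /andP[d0 d1] qd qc q3; have [d_le|d_gt] := leP d (7 / 100).
  by apply: (collision_near_euler qw _ qd qc q3); rewrite d0.
by apply: (collision_far_from_euler qw _ qd); rewrite (ltW d_gt).
Qed.

Lemma period_around_euler q w c d eta : path_velocity q w ->
  0 <= d <= 1 / 4 -> q (c + d * T) = 0 -> q (c - d * T) = 0 ->
  2 * eta <= enorm (q c) ->
  enorm (q (c + T / 3)) <= eta -> enorm (q (c - T / 3)) <= eta ->
  ((23 / 5 * X)%:E <= arc_action m q w (c - T / 2) (c - T / 2 + T))%E.
Proof.
move=> qw d01 qdr qdl qc qr ql.
have Hr := half_period_from_euler qw d01 qdr qc qr.
have q'w := path_velocity_reflect (c + c) qw.
have E y : c + c - (c + y) = c - y by ring.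
have Hl : ((23 / 10 * X)%:E <= arc_action m q w (c - T / 2) c)%E.
  rewrite -[X in arc_action _ _ _ _ X](addrK c) -(E (T / 2)) -arc_action_reflect//.
  by apply: (half_period_from_euler (eta := eta) q'w d01); rewrite ?E ?addrK.
have -> : c - T / 2 + T = c + T / 2 by field.
have [h1 h2] : c - T / 2 <= c /\ c <= c + T / 2 by move: T0; split; lra.
apply: le_trans (arc_action_cat_le m0 qw h1 h2 Hl Hr).
by rewrite lee_fin le_eqVlt; apply/orP; left; apply/eqP; field; rewrite gt_eqF.
Qed.

End HalfPeriod.

(** * Periodicity and the sides of the triangle *)

Section PeriodicPaths.
Context {R : realType}.
Local Notation V := 'rV[R]_2.
Local Notation mu := (@lebesgue_measure R).
Implicit Types (q w : R -> V) (m : R).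

Lemma path_velocity_unique q w1 w2 a b : path_velocity q w1 -> path_velocity q w2 ->
  {ae mu, forall t, t \in `[a, b] -> w1 t = w2 t}.
Proof.
move=> h1 h2.
have u0 := weak_derivative_unique (a - 1) (h1 ord0) (h2 ord0).
have u1 := weak_derivative_unique (a - 1) (h1 ord_max) (h2 ord_max).
apply: filterS2 u0 u1; first exact: (ae_filter_ringOfSetsType mu).
move=> t e0 e1; rewrite in_itv/= => /andP[at_ _].
have lt_at : a - 1 < t by lra.
apply/rowP => -[[|[|//]] i].
  by have := e0 lt_at; congr (_ = _); congr (_ _ _); exact: val_inj.
by have := e1 lt_at; congr (_ = _); congr (_ _ _); exact: val_inj.
Qed.

Lemma arc_action_eq m q w1 w2 a b : 0 < m -> path_velocity q w1 -> path_velocity q w2 ->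
  arc_action m q w1 a b = arc_action m q w2 a b.
Proof.
move=> m0 h1 h2; apply: ge0_ae_eq_integral => //.
- by apply: measurable_funTS; exact: kepler_measurable h1.
- by apply: measurable_funTS; exact: kepler_measurable h2.
- by move=> t _; exact: kepler_ge0.
- by move=> t _; exact: kepler_ge0.
have := path_velocity_unique a b h1 h2.
apply: filterS; first exact: (ae_filter_ringOfSetsType mu).
by move=> t E tab; rewrite /kepler E.
Qed.

(** Only the positions are assumed to be periodic; the velocity then is so almost
    everywhere, by uniqueness of weak derivatives. *)
Lemma arc_action_periodic m q w tau a b : 0 < m -> path_velocity q w ->
  (forall t, q (t + tau) = q t) ->
  arc_action m q w (a + tau) (b + tau) = arc_action m q w a b.
Proof.
move=> m0 qw per.
rewrite {1}/arc_action -integral_translate; last exact: kepler_measurable qw.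
have qw' : path_velocity q (fun t => w (t + tau)).
  have := path_velocity_translate tau qw.
  by congr path_velocity; apply/funext => t; rewrite per.
rewrite -(arc_action_eq a b m0 qw' qw); apply: eq_integral => t _.
by rewrite /kepler per.
Qed.

Lemma periodic_int (Y : Type) (f : R -> Y) (T : R) : (forall y, f (y + T) = f y) ->
  forall (n : int) y, f (y + n%:~R * T) = f y.
Proof.
move=> per; have pern k y : f (y + k%:R * T) = f y.
  elim: k y => [|k IH] y; first by rewrite mul0r addr0.
  by rewrite -[RHS]IH -[RHS]per; congr f; rewrite mulrSr; ring.
case=> k y; first exact: pern.
by rewrite NegzE -[LHS](pern k.+1) mulrNz; congr f; rewrite -pmulrn; ring.
Qed.

Lemma arc_action_period m q w T c : 0 < m -> 0 < T -> path_velocity q w ->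
  (forall t, q (t + T) = q t) ->
  arc_action m q w c (c + T) = arc_action m q w 0 T.
Proof.
move=> m0 T0 qw per.
(* e is the representative of c in [0, T) *)
pose n := Num.floor (c / T); pose e := c - n%:~R * T.
have /andP[n1 n2] := real_floor_itv (num_real (c / T)).
have e0 : 0 <= e by rewrite subr_ge0 -ler_pdivlMr.
have eT : e <= T.
  move: n2; rewrite ltr_pdivrMr// intrD mulrDl mul1r => /ltW; rewrite /e -/n; lra.
have -> : c = e + n%:~R * T by rewrite subrK.
have -> : e + n%:~R * T + T = e + T + n%:~R * T by ring.
rewrite (arc_action_periodic _ _ m0 qw (periodic_int per n)).
rewrite (@arc_action_cat _ m q w e T (e + T))//; last by rewrite lerDr.
have := arc_action_periodic 0 e m0 qw per; rewrite add0r => ->.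
by rewrite addeC -arc_action_cat.
Qed.

End PeriodicPaths.

Section ThreeBody.
Context {R : realType}.
Local Notation V := 'rV[R]_2.
Local Notation mu := (@lebesgue_measure R).
Implicit Types (x : R -> 'I_3 -> V) (m T : R) (i : 'I_3).

(** Consecutive bodies in cyclic order, so that cyclic symmetries permute the
    sides without changing signs. *)
Definition side x i (t : R) : V := x t i - x t (i + 1).

Definition side_velocity x i (t : R) : V := velocity x i t - velocity x (i + 1) t.

Lemma wderivP (f : R -> R) : H1loc f -> weak_derivative f (wderiv f).
Proof. by move=> fH; exact: (xgetPex (cst 0) fH). Qed.

Lemma loop_velocity T x i : loop T x -> path_velocity (x^~ i) (velocity x i).
Proof.
move=> [_ _ xH] k; have := wderivP (xH i k).
by congr weak_derivative; apply/funext => t; rewrite mxE.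
Qed.

Lemma side_path_velocity T x i : loop T x ->
  path_velocity (side x i) (side_velocity x i).
Proof. by move=> lx; apply: path_velocity_sub; exact: loop_velocity lx. Qed.

Lemma side_period T x i t : loop T x -> side x i (t + T) = side x i t.
Proof. by move=> [per _ _]; rewrite /side per. Qed.

Lemma pair_potentialN m (r : V) : pair_potential m (- r) = pair_potential m r.
Proof. by rewrite /pair_potential enormN oppr_eq0. Qed.

Lemma sum_ord3 (W : nmodType) (F : 'I_3 -> W) :
  \sum_i F i = F 0 + F 1 + F (1 + 1).
Proof.
rewrite !big_ord_recr big_ord0/= add0r.
by congr (F _ + F _ + F _); apply: val_inj.
Qed.

Lemma ord3_wrap : 1 + 1 + 1 = 0 :> 'I_3. Proof. exact: val_inj. Qed.

Lemma potential_sides m x t :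
  (\sum_(i < 3) \sum_(j < 3 | (i < j)%N) pair_potential m (x t i - x t j)%R =
   \sum_i pair_potential m (side x i t))%E.
Proof.
have sum3e (F : 'I_3 -> \bar R) : (\sum_i F i = F 0%R + F 1%R + F (1 + 1)%R)%E.
  exact: sum_ord3.
rewrite !sum3e ![(\sum_(j < 3 | _) _)%E]big_mkcond/= !sum3e/= !add0e !adde0.
rewrite /side ord3_wrap add0r -[(x t (1 + 1) - x t 0)%R]opprB pair_potentialN.
by rewrite addeAC.
Qed.

(** Leibniz's identity splits the kinetic energy over the three sides. *)
Lemma lagrangian_sides m x t :
  lagrangian m x t =
  (\sum_i kepler m (side x i) (side_velocity x i) t +
   (m / 6 * enorm (\sum_i velocity x i t) ^+ 2)%:E)%E.
Proof.
rewrite /lagrangian potential_sides big_split/= sumEFin -addeA addeCA addeC -EFinD.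
congr (_%:E + _)%E; rewrite !sum_ord3 /side_velocity ord3_wrap add0r.
by rewrite !sqr_enorm !dotpE !mxE; field.
Qed.

Lemma lagrangian_ge0 m x t : 0 < m -> (0 <= lagrangian m x t)%E.
Proof.
move=> m0; rewrite lagrangian_sides adde_ge0//.
  by apply: sume_ge0 => i _; exact: kepler_ge0.
by rewrite lee_fin mulr_ge0 ?sqr_ge0// divr_ge0// ltW.
Qed.

Lemma sides_measurable m T x : loop T x -> measurable_fun setT
  (fun t => \sum_i kepler m (side x i) (side_velocity x i) t)%E.
Proof.
move=> lx; apply: emeasurable_sum => i.
by apply: kepler_measurable; exact: side_path_velocity lx.
Qed.

Lemma lagrangian_measurable m T x : loop T x -> measurable_fun setT (lagrangian m x).
Proof.
move=> lx; rewrite (funext (lagrangian_sides m x)).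
apply: emeasurable_funD; first exact: sides_measurable lx.
apply/measurable_EFinP/measurable_funM => //; apply/measurable_funX.
have mv i k : measurable_fun setT (fun t => velocity x i t 0 k).
  by have [] := loop_velocity i lx k.
have ms k : measurable_fun setT (fun t => (\sum_i velocity x i t) 0 k).
  by under eq_fun do rewrite summxE; exact: measurable_sum.
apply: (measurableT_comp measurable_sqrt).
by under eq_fun do rewrite dotpE; apply: measurable_funD; exact: measurable_funM.
Qed.

(** The period over which a side is examined may start at a time of its own,
    adapted to the collisions of that pair. *)
Lemma lagrangian_action_sides m T x (y : R) : 0 < m -> 0 < T -> loop T x ->
  (forall i, exists c, (y%:E <=
     arc_action m (side x i) (side_velocity x i) c (c + T))%E) ->
  ((3 * y)%:E <= lagrangian_action m T x)%E.
Proof.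
move=> m0 T0 lx hy.
have mK i : measurable_fun setT (kepler m (side x i) (side_velocity x i)).
  by apply: kepler_measurable; exact: side_path_velocity lx.
have S0 t : (0 <= \sum_i kepler m (side x i) (side_velocity x i) t)%E.
  by apply: sume_ge0 => i _; exact: kepler_ge0.
have sum_le : ((3 * y)%:E <= \int[mu]_(t in `[0%R, T])
    \sum_i kepler m (side x i) (side_velocity x i) t)%E.
  rewrite ge0_integral_sum//; last 2 first.
  - by move=> i; apply: measurable_funTS; exact: mK.
  - by move=> i t _; exact: kepler_ge0.
  have -> : ((3 * y)%:E = \sum_(i < 3) y%:E)%E.
    by rewrite !big_ord_recr big_ord0/= add0e -!EFinD; congr EFin; ring.
  apply: lee_sum => i _; have [c hc] := hy i; apply: le_trans hc _.
  rewrite (arc_action_period (T := T) _ m0 T0 (side_path_velocity i lx))//.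
  by move=> t; exact: side_period lx.
apply: le_trans sum_le _; rewrite /lagrangian_action.
apply: ge0_le_integral => //.
- by apply: measurable_funTS; exact: sides_measurable lx.
- by apply: measurable_funTS; exact: lagrangian_measurable lx.
- by move=> t _; rewrite lagrangian_sides leeDl// lee_fin mulr_ge0 ?sqr_ge0// divr_ge0// ltW.
Qed.

End ThreeBody.

(** * Invariant loops with a collision *)

Section CollidingLoops.
Context {R : realType}.
Local Notation V := 'rV[R]_2.
Variables (u : V) (m l T : R).
Hypotheses (m0 : 0 < m) (l0 : 0 < l) (T0 : 0 < T) (lT : l ^+ 3 = m * T ^+ 2).
Implicit Types (x : R -> 'I_3 -> V) (i : 'I_3).
Local Notation X := (m * l ^+ 2 / T).

Lemma collision_side x t : ~ collision_free (x t) -> exists i, side x i t = 0.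
Proof.
move=> nf; have [a [b [ab xab]]] : exists a b, a != b /\ x t a = x t b.
  apply: contrapT => none; apply: nf => a b xab; apply/eqP.
  by apply/negP => /negP ab; apply: none; exists a, b.
have : (b == a + 1) || (a == b + 1).
  by move: ab; case: a {xab} => [[|[|[|//]]] ?]; case: b => [[|[|[|//]]] ?].
case/orP => /eqP E; [exists a|exists b]; by rewrite /side -E xab subrr.
Qed.

Lemma every_side_by_steps (P : 'I_3 -> R -> Prop) i t tau : P i t ->
  (forall j t', P j t' -> P (j + 1) (t' + tau)) -> forall j, exists t', P j t'.
Proof.
move=> p0 step j; have p1 := step _ _ p0; have p2 := step _ _ p1.
have : [|| j == i, j == i + 1 | j == i + 1 + 1].
  by case: j => [[|[|[|//]]] ?]; case: (i) => [[|[|[|//]]] ?].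
by case/or3P => /eqP->; [exists t|exists (t + tau)|exists (t + tau + tau)].
Qed.

Lemma cyclic_loop_action x t : invariant_loop u T <[s]>%g x ->
  ~ collision_free (x t) -> ((69 / 5 * X)%:E <= lagrangian_action m T x)%E.
Proof.
move=> [lx inv] /collision_side[i0 xi0].
have shift t' i : x (t' + T / 6) i = reflection u (x t' (i - 1)).
  by have := inv s (cycle_id s) t'; rewrite /beta/= mul1r => ->.
have step i t' : side x i t' = 0 -> side x (i + 1) (t' + T / 6) = 0.
  by rewrite /side !shift !addrK => /subr0_eq ->; rewrite subrr.
have -> : 69 / 5 * X = 3 * (23 / 5 * X) by field; rewrite gt_eqF.
apply: lagrangian_action_sides => // i.
have [c xc] := every_side_by_steps xi0 step i; exists c.
apply: (period_of_collisions m0 l0 T0 lT) => //.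
- exact: side_path_velocity lx.
- have := step _ _ (step _ _ (step _ _ xc)).
  have -> : i + 1 + 1 + 1 = i by apply: val_inj; case: (i) => [[|[|[|//]]] ?].
  by congr (side x i _ = 0); field.
- by rewrite side_period.
Qed.

Lemma dihedral_loop_action x t :
  invariant_loop u T <<[set (s ^+ 2)%g; sigma]%SET>>%g x -> u != 0 ->
  ~ collision_free (x t) -> ((69 / 5 * X)%:E <= lagrangian_action m T x)%E.
Proof.
move=> [lx inv] u0 /collision_side[i0 xi0].
have [per _ _] := lx.
have shift t' i : x (t' + T / 3) i = x t' (i - 1 - 1).
  have s2 : (s ^+ 2)%g \in <<[set (s ^+ 2)%g; sigma]%SET>>%g.
    by apply: mem_gen; rewrite !inE eqxx.
  have := inv _ s2 t'; have -> : (s ^+ 2 = Dihedral 2%:R false)%g by apply/eqP.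
  rewrite /beta/=; have -> : t' + 2%:R * (T / 6) = t' + T / 3 by field.
  by move=> ->; rewrite /alpha/= /alpha_s reflectionK.
have flip t' i : x (- t') i = - x t' (- i).
  have sg : sigma \in <<[set (s ^+ 2)%g; sigma]%SET>>%g.
    by apply: mem_gen; rewrite !inE eqxx orbT.
  by have := inv _ sg t'; rewrite /beta/= mul0r addr0 => ->.
have shift2 t' i : x (t' + 2 / 3 * T) i = x t' (i - 1).
  have -> : t' + 2 / 3 * T = t' + T / 3 + T / 3 by field.
  rewrite !shift; congr (x t' _); apply: val_inj.
  by case: i => [[|[|[|//]]] ?].
have step i t' : side x i t' = 0 -> side x (i + 1) (t' + 2 / 3 * T) = 0.
  by rewrite /side !shift2 !addrK.
(* From here on, side 1 between the bodies 1 and 2 stands for all sides: the others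
   are its translates in time. *)
have [t1 xt1] := every_side_by_steps xi0 step 1.
(* c is the integer multiple of T / 2 nearest to the collision time t1 *)
pose n := Num.floor (2 * t1 / T + 1 / 2); pose c := n%:~R * (T / 2).
have /andP[n1 n2] := real_floor_itv (num_real (2 * t1 / T + 1 / 2)).
have T_neq0 : T != 0 by rewrite gt_eqF.
have t1E : t1 = 2 * t1 / T * (T / 2) by field.
have [c1 c2] : t1 - c <= T / 4 /\ c - t1 <= T / 4.
  have := T0; rewrite intrD in n2; move: n1 n2; rewrite -/n => n1 n2 TT.
  rewrite /c {1}t1E [in X in _ /\ X]t1E -!mulrBl; split; nra.
have reflect t' i : x (c + c - t') i = - x t' (- i).
  by rewrite -flip -(periodic_int per n (- t')); congr (x _ i); rewrite /c; field.
have [e11 eN10 eN1] : [/\ 1 + 1 = - 1 :> 'I_3, - 1 + 1 = 0 :> 'I_3 & - 1 - 1 = 1 :> 'I_3].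
  by split; exact: val_inj.
have side1 t' : side x 1 t' = x t' 1 - x t' (- 1) by rewrite /side e11.
have sideN t' : side x 1 (c + c - t') = side x 1 t'.
  by rewrite !side1 !reflect opprK opprK addrC.
(* The configuration at time c is an Euler configuration. *)
have xc0 : x c 0 = 0.
  have /eqP := reflect c 0; rewrite addrK oppr0 -subr_eq0 opprK.
  by rewrite -mulr2n -scaler_nat scaler_eq0 pnatr_eq0 => /eqP.
have xcN : x c (- 1) = - x c 1 by rewrite -{1}(addrK c c) reflect opprK.
pose d := `|t1 - c| / T; pose eta := enorm (x c 1).
have dT : d * T = `|t1 - c| by rewrite divfK.
have d01 : 0 <= d <= 1 / 4.
  rewrite divr_ge0 ?(ltW T0)//= ler_pdivrMr// ler_norml; lra.
have [sr sl] : side x 1 (c + d * T) = 0 /\ side x 1 (c - d * T) = 0.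
  have refl_t1 y : y = c + c - t1 -> side x 1 y = 0 by move=> ->; rewrite sideN.
  rewrite dT; case: ger0P => _; split; try by rewrite -xt1; congr side; ring.
  - by apply: refl_t1; ring.
  - by apply: refl_t1; ring.
have mid : 2 * eta <= enorm (side x 1 c).
  rewrite side1 xcN opprK /eta le_eqVlt; apply/orP; left; apply/eqP.
  have -> : enorm (x c 1 + x c 1) = Num.sqrt (2 ^+ 2 * dotp (x c 1) (x c 1)).
    by congr Num.sqrt; rewrite !dotpE !mxE; ring.
  by rewrite sqrtrM ?sqr_ge0// sqrtr_sqr ger0_norm.
have near_r : enorm (side x 1 (c + T / 3)) <= eta.
  by rewrite side1 !shift !eN1 subrr sub0r xc0 subr0 xcN enormN.
have near_l : enorm (side x 1 (c - T / 3)) <= eta.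
  have -> : c - T / 3 = c + 2 / 3 * T - T by field.
  have perN y : x (y - T) = x y by rewrite -per subrK.
  by rewrite side1 !perN !shift2 eN1 subrr xc0 sub0r enormN.
have -> : 69 / 5 * X = 3 * (23 / 5 * X) by field; rewrite gt_eqF.
apply: lagrangian_action_sides => // i.
have [tau sideE] : exists tau, forall y, side x i y = side x 1 (y + tau).
  have : [|| i == 1, i == - 1 | i == 0] by case: i => [[|[|[|//]]] ?].
  case/or3P => /eqP ->.
  - by exists 0 => y; rewrite addr0.
  - by exists (T / 3) => y; rewrite side1 !shift !eN1 subrr sub0r /side eN10.
  - by exists (2 / 3 * T) => y; rewrite side1 !shift2 eN1 subrr /side add0r.
exists (c - tau - T / 2).
apply: (period_around_euler m0 l0 T0 lT (d := d) (eta := eta)) => //.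
- exact: side_path_velocity lx.
- by rewrite sideE -sr; congr side; ring.
- by rewrite sideE -sl; congr side; ring.
- by rewrite sideE subrK.
- by have -> : side x i (c - tau + T / 3) = side x 1 (c + T / 3) by rewrite sideE; congr side; ring.
- by have -> : side x i (c - tau - T / 3) = side x 1 (c - T / 3) by rewrite sideE; congr side; ring.
Qed.

End CollidingLoops.

(** * Trigonometric estimates and smooth paths *)

Section Trigonometry.
Context {R : realType}.
Implicit Types (x : R).

Lemma ge0_of_derive (f df : R -> R) : f 0 = 0 -> (forall x, is_derive x 1 f (df x)) ->
  (forall x, 0 <= x -> 0 <= df x) -> forall x, 0 <= x -> 0 <= f x.
Proof.
move=> f0 fdf df0 x; rewrite le_eqVlt => /orP[/eqP<-|x0]; first by rewrite f0.
have cf : {within `[0, x], continuous f}.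
  apply: continuous_subspaceT => y; apply/differentiable_continuous/derivable1_diffP.
  exact: ex_derive.
have [c] := MVT x0 (fun y _ => fdf y) cf.
rewrite in_itv/= => /andP[c0 _]; rewrite f0 subr0 => ->.
by rewrite mulr_ge0 ?df0 ?subr0// ltW.
Qed.

(** The Taylor polynomials of sine and cosine are alternately below and above
    them, each inequality being the derivative of the next one. *)
Lemma cos_le_taylor4 x : 0 <= x -> cos x <= 1 - x ^+ 2 / 2 + x ^+ 4 / 24.
Proof.
have s1 : forall y : R, 0 <= y -> 0 <= y - sin y.
  apply: (@ge0_of_derive _ (fun y => 1 - cos y)); first by rewrite sin0 subrr.
  by move=> y _; rewrite subr_ge0 cos_le1.
have c2 : forall y : R, 0 <= y -> 0 <= cos y - 1 + y ^+ 2 / 2.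
  apply: (@ge0_of_derive _ (fun y => y - sin y)) => //.
    by rewrite cos0 subrr expr0n mul0r addr0.
  by move=> y; apply: is_derive_eq; rewrite /GRing.scale/=; field.
have s3 : forall y : R, 0 <= y -> 0 <= sin y - y + y ^+ 3 / 6.
  apply: (@ge0_of_derive _ (fun y => cos y - 1 + y ^+ 2 / 2)) => //.
    by rewrite sin0 subrr expr0n mul0r addr0.
  by move=> y; apply: is_derive_eq; rewrite /GRing.scale/=; field.
have c4 : forall y : R, 0 <= y -> 0 <= 1 - y ^+ 2 / 2 + y ^+ 4 / 24 - cos y.
  apply: (@ge0_of_derive _ (fun y => sin y - y + y ^+ 3 / 6)) => //.
    by rewrite cos0 !expr0n !mul0r subr0 addr0 subrr.
  by move=> y; apply: is_derive_eq; rewrite /GRing.scale/=; field.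
by move=> x0; rewrite -subr_ge0 c4.
Qed.

(** The Taylor bound is negative at 8/5, so cosine vanishes before. *)
Lemma pi_lt_16_5 : pi < 16 / 5 :> R.
Proof.
rewrite ltNge; apply/negP => pi_ge.
have : 0 <= cos (8 / 5 : R) by apply: cos_ge0_pihalf; lra.
have := @cos_le_taylor4 (8 / 5) ltac:(lra); lra.
Qed.

(** The triple-angle formula gives (c + 1) (2 c - 1)^2 = 0. *)
Lemma cos_pi3 : cos (pi / 3) = 1 / 2 :> R.
Proof.
set c := cos _.
have c0 : 0 < c by apply: cos_gt0_pihalf; have := @pi_gt0 R; lra.
have : cos (pi / 3 + (pi / 3 + pi / 3)) = - 1 :> R.
  by rewrite -cospi; congr cos; field.
rewrite cosD cosD sinD -/c; set s := sin _.
have cs : s ^+ 2 = 1 - c ^+ 2 by rewrite /s /c sin2cos2.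
have -> : c * (c * c - s * s) - s * (s * c + c * s) = c ^+ 3 - 3 * c * s ^+ 2 by ring.
rewrite cs => e; have : (c + 1) * (2 * c - 1) ^+ 2 = 0 by nra.
move/eqP; rewrite mulf_eq0 gt_eqF/= ?addr_gt0// sqrf_eq0 subr_eq0 => /eqP; lra.
Qed.

Lemma sin_pi3 : sin (pi / 3) = Num.sqrt 3 / 2 :> R.
Proof.
have s0 : 0 <= sin (pi / 3) :> R by apply: sin_ge0_pi; have := @pi_gt0 R; lra.
apply: (@pexpIrn _ 2) => //; rewrite ?nnegrE ?divr_ge0 ?sqrtr_ge0//.
by rewrite sin2cos2 cos_pi3 [in RHS]expr_div_n sqr_sqrtr//; field.
Qed.

End Trigonometry.

Section SmoothWeakDerivative.
Context {R : realType}.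
Local Notation mu := (@lebesgue_measure R).

Lemma smooth_weak_derivative (f df : R -> R) :
  (forall x : R, is_derive x 1 f (df x)) -> continuous df -> weak_derivative f df.
Proof.
move=> fdf cdf.
have cf : continuous f.
  move=> y; apply/differentiable_continuous/derivable1_diffP; exact: ex_derive.
have mdf : measurable_fun setT df by exact: continuous_measurable_fun.
split=> // [a b|a b].
  have : mu.-integrable `[a, b] (EFin \o (fun t => df t * df t)).
    apply: continuous_compact_integrable => //; first exact: segment_compact.
    apply: continuous_subspaceT => y; exact: continuousM (cdf y) (cdf y).
  by move/integrable_lty; apply.
rewrite le_eqVlt => /orP[/eqP<-|ab]; first by rewrite subrr set_itv1 Rintegral_set1.
rewrite /Rintegral (@continuous_FTC2 _ _ f)//.
- exact: continuous_subspaceT.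
- split=> [t _||].
  + exact: ex_derive.
  + exact: cvg_at_right_filter (cf a).
  + exact: cvg_at_left_filter (cf b).
- by move=> t _; rewrite derive1E derive_val.
Qed.

End SmoothWeakDerivative.

(** * The figure eight *)

Section FigureEight.
Context {R : realType}.
Local Notation V := 'rV[R]_2.
Local Notation mu := (@lebesgue_measure R).
Variables (u : V) (m l T : R).
Hypotheses (u0 : u != 0) (m0 : 0 < m) (l0 : 0 < l) (T0 : 0 < T).
Hypothesis (lT : l ^+ 3 = m * T ^+ 2).
Implicit Types (i : 'I_3).

Let N := enorm u.
Let N0 : N != 0. Proof. by rewrite enorm_eq0. Qed.
Let NE : N ^+ 2 = u 0 ord0 ^+ 2 + u 0 ord_max ^+ 2.
Proof. by rewrite sqr_enorm dotpE !expr2. Qed.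

(** Coordinates in the orthonormal frame whose first axis is the line of the
    reflection. *)
Definition frame (x y : R) : V :=
  \row_k ((if k == ord0 then x * u 0 ord0 - y * u 0 ord_max
           else x * u 0 ord_max + y * u 0 ord0) / N).

Lemma dotp_frame x y : dotp (frame x y) (frame x y) = x ^+ 2 + y ^+ 2.
Proof.
rewrite dotpE !mxE/=.
have -> : (x * u 0 ord0 - y * u 0 ord_max) / N * ((x * u 0 ord0 - y * u 0 ord_max) / N) +
  (x * u 0 ord_max + y * u 0 ord0) / N * ((x * u 0 ord_max + y * u 0 ord0) / N) =
  (x ^+ 2 + y ^+ 2) * (u 0 ord0 ^+ 2 + u 0 ord_max ^+ 2) / N ^+ 2 by field.
by rewrite -NE mulfK// expf_neq0.
Qed.

Lemma frameN x y : frame (- x) (- y) = - frame x y.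
Proof. by apply/rowP => k; rewrite !mxE; case: ifP => _; field. Qed.

Lemma frameB x y x' y' : frame x y - frame x' y' = frame (x - x') (y - y').
Proof. by apply/rowP => k; rewrite !mxE; case: ifP => _; field. Qed.

Lemma reflection_frame x y : reflection u (frame x y) = frame x (- y).
Proof.
have uu : dotp u u = N ^+ 2 by rewrite sqr_enorm.
have fu : dotp (frame x y) u = x * N.
  rewrite dotpE !mxE/=.
  have -> : x * N = x * N ^+ 2 / N by field.
  by rewrite NE; field.
rewrite /reflection uu fu; apply/rowP => -[[|[|//]] k]; rewrite !mxE/=.
  have -> : Ordinal k = ord0 by exact: val_inj.
  by field.
have -> : Ordinal k = ord_max by exact: val_inj.
by field.
Qed.

Let omega := 2 * pi / T.
Let h : R := Num.sqrt 3 / 2.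
Let h2 : h ^+ 2 = 3 / 4.
Proof. by rewrite /h expr_div_n sqr_sqrtr//; field. Qed.

(** Cosine and sine of 2 pi i / 3, written algebraically; sin3 and cos3 below are
    the sine and cosine of omega t + 2 pi i / 3. *)
Definition root_cos i : R := if i == 0 then 1 else - (1 / 2).
Definition root_sin i : R := if i == 0 then 0 else if i == 1 then h else - h.
Definition sin3 i t := sin (omega * t) * root_cos i + cos (omega * t) * root_sin i.
Definition cos3 i t := cos (omega * t) * root_cos i - sin (omega * t) * root_sin i.

Lemma ord3_ind (P : 'I_3 -> Prop) : P 0 -> P 1 -> P (- 1) -> forall i, P i.
Proof.
move=> p0 p1 p2 i; have : [|| i == 0, i == 1 | i == - 1].
  by case: i => [[|[|[|//]]] ?].
by case/or3P => /eqP->.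
Qed.

Lemma root_pythagoras i : root_cos i ^+ 2 + root_sin i ^+ 2 = 1.
Proof.
by elim/ord3_ind: i; rewrite /root_cos /root_sin/= ?sqrrN ?h2; field.
Qed.

Lemma cos3_sin3 i t : cos3 i t ^+ 2 + sin3 i t ^+ 2 = 1.
Proof.
have e := cos2Dsin2 (omega * t); have e' := root_pythagoras i.
rewrite -[RHS](mulr1 1) -{1}e -e' /cos3 /sin3; ring.
Qed.

Lemma sin3_next i t : sin3 (i + 1) t = - (1 / 2) * sin3 i t + h * cos3 i t.
Proof.
have := congr1 ( *%R (sin (omega * t))) h2.
have := congr1 ( *%R (cos (omega * t))) h2.
by elim/ord3_ind: i; rewrite /sin3 /cos3 /root_cos /root_sin/=; lra.
Qed.

Lemma cos3_next i t : cos3 (i + 1) t = - (1 / 2) * cos3 i t - h * sin3 i t.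
Proof.
have := congr1 ( *%R (sin (omega * t))) h2.
have := congr1 ( *%R (cos (omega * t))) h2.
by elim/ord3_ind: i; rewrite /sin3 /cos3 /root_cos /root_sin/=; lra.
Qed.

Lemma phase_shift t : omega * (t + T / 6) = omega * t + pi / 3.
Proof. by rewrite /omega; field; rewrite gt_eqF. Qed.

Lemma sin3_shift i t : sin3 i (t + T / 6) = - sin3 (i - 1) t.
Proof.
have -> : sin3 i (t + T / 6) = 1 / 2 * sin3 i t + h * cos3 i t.
  by rewrite /sin3 /cos3 phase_shift sinD cosD cos_pi3 sin_pi3 -/h; ring.
have := sin3_next (i - 1) t; have := cos3_next (i - 1) t; rewrite !subrK => -> ->.
have := congr1 ( *%R (sin3 (i - 1) t)) h2; lra.
Qed.

Lemma cos3_shift i t : cos3 i (t + T / 6) = - cos3 (i - 1) t.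
Proof.
have -> : cos3 i (t + T / 6) = 1 / 2 * cos3 i t - h * sin3 i t.
  by rewrite /sin3 /cos3 phase_shift sinD cosD cos_pi3 sin_pi3 -/h; ring.
have := sin3_next (i - 1) t; have := cos3_next (i - 1) t; rewrite !subrK => -> ->.
have := congr1 ( *%R (cos3 (i - 1) t)) h2; lra.
Qed.

Lemma sin3_opp i t : sin3 i (- t) = - sin3 (- i) t.
Proof.
rewrite /sin3 mulrN sinN cosN; elim/ord3_ind: i;
  rewrite ?oppr0 ?opprK /root_cos /root_sin/=; ring.
Qed.

Lemma cos3_opp i t : cos3 i (- t) = cos3 (- i) t.
Proof.
rewrite /cos3 mulrN sinN cosN; elim/ord3_ind: i;
  rewrite ?oppr0 ?opprK /root_cos /root_sin/=; ring.
Qed.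

(** Body i follows the Lissajous curve with coordinates proportional to
    sin (2 theta) along the axis and sin theta across it, where
    theta = omega t + 2 pi i / 3. The amplitudes 3/25 and 3/10 nearly minimize the
    bound obtained for the action. *)
Definition eight t i : V :=
  frame (3 / 25 * l * (2 * sin3 i t * cos3 i t)) (3 / 10 * l * sin3 i t).

Lemma eight_shift t : eight (t + T / 6) = alpha_s u (eight t).
Proof.
apply/funext => i; rewrite /alpha_s /eight reflection_frame sin3_shift cos3_shift.
by congr frame; ring.
Qed.

Lemma eight_opp t : eight (- t) = alpha_sigma (eight t).
Proof.
apply/funext => i; rewrite /alpha_sigma /eight -frameN sin3_opp cos3_opp.
by congr frame; ring.
Qed.

Lemma eight_period t : eight (t + T) = eight t.
Proof.
have -> : t + T = t + T / 6 + T / 6 + T / 6 + T / 6 + T / 6 + T / 6 by field.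
by rewrite !eight_shift -[RHS](alpha_s_order (eight t) u0).
Qed.

Lemma eight_invariant G : invariant_under u T G eight.
Proof.
move=> g _ t; have shiftn (k : nat) y :
    eight (y + k%:R * (T / 6)) = iter k (alpha_s u) (eight y).
  elim: k => [|k IH]; first by rewrite mul0r addr0.
  by rewrite iterS -IH -eight_shift; congr eight; rewrite mulrSr; ring.
by rewrite /beta shiftn /alpha; case: (flip g); rewrite ?eight_opp.
Qed.

Definition eight_velocity i t : V :=
  frame (3 / 25 * l * omega * (2 * (cos3 i t ^+ 2 - sin3 i t ^+ 2)))
        (3 / 10 * l * omega * cos3 i t).

Lemma is_derive_sin3 i (t : R) : is_derive t 1 (sin3 i) (omega * cos3 i t).
Proof.
rewrite /sin3; apply: is_derive_eq.
rewrite /GRing.scale/= /cos3; ring.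
Qed.

Lemma is_derive_cos3 i (t : R) : is_derive t 1 (cos3 i) (- omega * sin3 i t).
Proof.
rewrite /cos3; apply: is_derive_eq.
rewrite /GRing.scale/= /sin3; ring.
Qed.

Lemma frame_path_velocity (X Y dX dY : R -> R) :
  (forall t : R, is_derive t 1 X (dX t)) -> (forall t : R, is_derive t 1 Y (dY t)) ->
  continuous dX -> continuous dY ->
  path_velocity (fun t => frame (X t) (Y t)) (fun t => frame (dX t) (dY t)).
Proof.
move=> hX hY cX cY k.
pose coord (x y : R) := (if k == ord0 then x * u 0 ord0 - y * u 0 ord_max
  else x * u 0 ord_max + y * u 0 ord0) / N.
suff : weak_derivative (fun t => coord (X t) (Y t)) (fun t => coord (dX t) (dY t)).
  by congr weak_derivative; apply/funext => t; rewrite mxE.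
apply: smooth_weak_derivative => [t|t]; rewrite /coord; case: (k == ord0).
- by apply: is_derive_eq; rewrite /GRing.scale/=; field.
- by apply: is_derive_eq; rewrite /GRing.scale/=; field.
- apply: cvgM; last exact: cvg_cst.
  by apply: cvgB; apply: cvgM ; [exact: cX|exact: cvg_cst|exact: cY|exact: cvg_cst].
- apply: cvgM; last exact: cvg_cst.
  by apply: cvgD; apply: cvgM ; [exact: cX|exact: cvg_cst|exact: cY|exact: cvg_cst].
Qed.

Lemma eight_path_velocity i : path_velocity (eight^~ i) (eight_velocity i).
Proof.
have ds := is_derive_sin3 i; have dc := is_derive_cos3 i.
have cs : continuous (sin3 i).
  by move=> t; apply/differentiable_continuous/derivable1_diffP; exact: ex_derive.
have cc : continuous (cos3 i).
  by move=> t; apply/differentiable_continuous/derivable1_diffP; exact: ex_derive.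
apply: frame_path_velocity => t.
- by apply: is_derive_eq; rewrite /GRing.scale/=; ring.
- by apply: is_derive_eq; rewrite /GRing.scale/=; ring.
- apply: cvgM; first exact: cvg_cst.
  apply: cvgM; first exact: cvg_cst.
  by apply: cvgB; apply: cvgM; [exact: cc|exact: cc|exact: cs|exact: cs].
- by apply: cvgM; [exact: cvg_cst|exact: cc].
Qed.

Lemma eight_centered t : centered (eight t).
Proof.
have frameD x y x' y' : frame x y + frame x' y' = frame (x + x') (y + y').
  by rewrite -[frame x' y']opprK -frameN frameB !opprK.
have frame0 : frame 0 0 = 0 by apply/rowP => k; rewrite !mxE; case: ifP => _; field.
have hm y : h ^+ 2 * y = 3 / 4 * y by rewrite h2.
pose sn := sin3 0 t; pose c := cos3 0 t.
have s1 : sin3 1 t = - (1 / 2) * sn + h * c := sin3_next 0 t.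
have c1 : cos3 1 t = - (1 / 2) * c - h * sn := cos3_next 0 t.
have s2 : sin3 (1 + 1) t = - (1 / 2) * sn - h * c.
  by rewrite sin3_next s1 c1; have := hm sn; lra.
have c2 : cos3 (1 + 1) t = - (1 / 2) * c + h * sn.
  by rewrite cos3_next s1 c1; have := hm c; lra.
rewrite /centered sum_ord3 /eight !frameD s1 c1 s2 c2 -/sn -/c -[RHS]frame0.
by congr frame; [have := hm (l * (sn * c)); lra|lra].
Qed.

Lemma eight_loop : loop T eight.
Proof.
split=> [t|t|i k]; [exact: eight_period|exact: eight_centered|].
by exists (fun t => eight_velocity i t 0 k); exact: eight_path_velocity.
Qed.

(** The side opposite to body i - 1 depends on the phase of that body only: with
    that phase theta, its coordinates are multiples of cos (2 theta) and cos theta. *)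
Lemma eight_side i t : side eight i t =
  frame (- (3 / 25 * l * Num.sqrt 3 * (2 * cos3 (i - 1) t ^+ 2 - 1)))
        (3 / 10 * l * Num.sqrt 3 * cos3 (i - 1) t).
Proof.
have -> : Num.sqrt 3 = 2 * h by rewrite /h; field.
have e : cos3 (i - 1) t = - (1 / 2) * cos3 i t + h * sin3 i t.
  have := sin3_next (i - 1) t; have := cos3_next (i - 1) t; rewrite !subrK => -> ->.
  have := congr1 ( *%R (cos3 (i - 1) t)) h2; lra.
rewrite /side /eight frameB; rewrite sin3_next cos3_next e.
set sn := sin3 i t; set c := cos3 i t.
have cs : c ^+ 2 + sn ^+ 2 = 1 := cos3_sin3 i t.
have hm y : h ^+ 2 * y = 3 / 4 * y by rewrite h2.
congr frame; last by have := hm (l * sn); lra.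
set k := - (1 / 2) * c + h * sn.
have -> : 2 * k ^+ 2 - 1 = 2 * k ^+ 2 - (c ^+ 2 + sn ^+ 2) by rewrite cs.
rewrite /k; have := hm (l * (sn * c)); have := hm (l * (h * sn ^+ 2)).
lra.
Qed.

(** With c = cos (2 theta), the second factor is the squared length of a side in
    units of l^2, so the quadratic polynomial exceeds the inverse length. The
    right-hand side minus 1 has positive coefficients in the Bernstein basis of
    degree 7 on [-1, 1]. *)
Lemma inverse_distance_majorant (c : R) : -1 <= c <= 1 ->
  1 <= (14 / 5 - 147 / 100 * c + 57 / 100 * c ^+ 2) ^+ 2 *
       (3 * (9 / 100 * ((1 + c) / 2) + 9 / 625 * c ^+ 2)).
Proof.
move=> /andP[c_ge c_le].
have h7 k n : 0 <= (1 + c) ^+ k * (1 - c) ^+ n.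
  by rewrite mulr_ge0 ?exprn_ge0//; lra.
have := h7 0%N 7%N; have := h7 1%N 6%N; have := h7 2%N 5%N; have := h7 3%N 4%N.
have := h7 4%N 3%N; have := h7 5%N 2%N; have := h7 6%N 1%N; have := h7 7%N 0%N.
move=> *; lra.
Qed.

(** Over three equally spaced phases, the square and the fourth power of the
    cosine have their mean values over a full turn. *)
Lemma cos3_power_sums t :
  cos3 0 t ^+ 2 + cos3 1 t ^+ 2 + cos3 (1 + 1) t ^+ 2 = 3 / 2 /\
  (cos3 0 t ^+ 2) ^+ 2 + (cos3 1 t ^+ 2) ^+ 2 + (cos3 (1 + 1) t ^+ 2) ^+ 2 = 9 / 8.
Proof.
have hm y : h ^+ 2 * y = 3 / 4 * y by rewrite h2.
have := cos3_sin3 0 t; set c := cos3 0 t; set sn := sin3 0 t => cs.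
have s1 : sin3 1 t = - (1 / 2) * sn + h * c := sin3_next 0 t.
have c1 : cos3 1 t = - (1 / 2) * c - h * sn := cos3_next 0 t.
have c2 : cos3 (1 + 1) t = - (1 / 2) * c + h * sn.
  by rewrite cos3_next s1 c1; have := hm c; lra.
rewrite c1 c2; split.
  by have := hm (sn ^+ 2); lra.
have := congr1 (fun y => y ^+ 2) cs.
have := hm (h ^+ 2 * sn ^+ 4); have := hm (sn ^+ 4); have := hm (c ^+ 2 * sn ^+ 2).
lra.
Qed.

Lemma eight_potential i t (c := 2 * cos3 (i - 1) t ^+ 2 - 1) :
  (pair_potential m (side eight i t) <=
   (m ^+ 2 / l * (14 / 5 - 147 / 100 * c + 57 / 100 * c ^+ 2))%:E)%E.
Proof.
set p := 14 / 5 - _ + _.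
have k2 : cos3 (i - 1) t ^+ 2 = (1 + c) / 2 by rewrite /c; field.
have c11 : -1 <= c <= 1.
  have := cos3_sin3 (i - 1) t; have := sqr_ge0 (cos3 (i - 1) t).
  have := sqr_ge0 (sin3 (i - 1) t); rewrite k2 => ? ? ?; apply/andP; split; lra.
have p0 : 0 < p.
  by move/andP: c11 => [? ?]; have := sqr_ge0 c; rewrite /p => ?; lra.
set e := enorm (side eight i t).
have e2 : e ^+ 2 = l ^+ 2 * (3 * (9 / 100 * ((1 + c) / 2) + 9 / 625 * c ^+ 2)).
  rewrite sqr_enorm eight_side -/c dotp_frame sqrrN !exprMn sqr_sqrtr// k2.
  by field.
have le_pe : l <= p * e.
  rewrite -ler_sqr ?nnegrE ?mulr_ge0 ?enorm_ge0 ?(ltW l0) ?(ltW p0)//.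
  rewrite exprMn e2 mulrCA -{1}[l ^+ 2]mulr1 ler_pM2l ?exprn_gt0//.
  exact: inverse_distance_majorant.
have e0 : 0 < e.
  rewrite lt_neqAle enorm_ge0 andbT eq_sym; apply: contraTneq le_pe => ->.
  by rewrite mulr0 -ltNge.
rewrite /pair_potential -enorm_eq0 gt_eqF// lee_fin ler_pdivrMr//.
have -> : m ^+ 2 / l * p * e = m ^+ 2 * (p * e / l) by field; rewrite gt_eqF.
by rewrite ler_peMr ?sqr_ge0// ler_pdivlMr// mul1r.
Qed.

(** 369/2500 is (3/10)^2 + 4 (3/25)^2, from the kinetic energy, and 1851/200 is
    3 (14/5) + (3/2) (57/100), the sum of the majorants over the three sides. *)
Definition eight_level : R := 369 / 2500 * 3 * pi ^+ 2 + 1851 / 200.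

Lemma eight_lagrangian t : (forall i, velocity eight i t = eight_velocity i t) ->
  (lagrangian m eight t <= (eight_level * (m * l ^+ 2 / T) / T)%:E)%E.
Proof.
move=> vE; rewrite /lagrangian potential_sides.
have [k2 k4] := cos3_power_sums t.
have kin : 2^-1 * \sum_i m * enorm (velocity eight i t) ^+ 2 =
    369 / 2500 * 3 * pi ^+ 2 * (m * l ^+ 2 / T) / T.
  pose F y := m * l ^+ 2 * omega ^+ 2 * (36 / 625 * (2 * y - 1) ^+ 2 + 9 / 100 * y).
  have -> : \sum_i m * enorm (velocity eight i t) ^+ 2 = \sum_i F (cos3 i t ^+ 2).
    apply: eq_bigr => i _; rewrite vE sqr_enorm dotp_frame.
    have -> : sin3 i t ^+ 2 = 1 - cos3 i t ^+ 2.
      by rewrite -(cos3_sin3 i t) addrC addKr.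
    by rewrite /F; field.
  rewrite sum_ord3 /F.
  move: k2 k4; set a := cos3 0 t ^+ 2; set b := cos3 1 t ^+ 2.
  set d := cos3 (1 + 1) t ^+ 2 => k2 k4.
  transitivity (2^-1 * (m * l ^+ 2 * omega ^+ 2 * (36 / 625 *
      (4 * (a ^+ 2 + b ^+ 2 + d ^+ 2) - 4 * (a + b + d) + 3) + 9 / 100 * (a + b + d)))).
    by field.
  by rewrite k2 k4 /omega; field; rewrite gt_eqF.
have pot : (\sum_i pair_potential m (side eight i t) <=
  (1851 / 200 * (m * l ^+ 2 / T) / T)%:E)%E.
  apply: le_trans (lee_sum _ (fun i _ => eight_potential i t)) _.
  rewrite sumEFin lee_fin -mulr_sumr sum_ord3 sub0r subrr addrK.
  have -> : - 1 = 1 + 1 :> 'I_3 by exact: val_inj.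
  move: k2 k4; set a := cos3 0 t ^+ 2; set b := cos3 1 t ^+ 2.
  set d := cos3 (1 + 1) t ^+ 2 => k2 k4.
  have mE : m ^+ 2 / l = m * l ^+ 2 / T / T.
    have -> : m * l ^+ 2 / T / T = m * l ^+ 3 / l / T ^+ 2 by field; rewrite !gt_eqF.
    by rewrite lT; field; rewrite !gt_eqF.
  have M0 : 0 < m ^+ 2 / l by rewrite divr_gt0// exprn_gt0.
  have -> : 1851 / 200 * (m * l ^+ 2 / T) / T = m ^+ 2 / l * (1851 / 200).
    by rewrite mE; field; rewrite gt_eqF.
  rewrite ler_pM2l//; lra.
have -> : eight_level * (m * l ^+ 2 / T) / T =
    369 / 2500 * 3 * pi ^+ 2 * (m * l ^+ 2 / T) / T + 1851 / 200 * (m * l ^+ 2 / T) / T.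
  by rewrite /eight_level mulrDl mulrDl.
by rewrite kin EFinD leeD2l.
Qed.

Lemma eight_action : (lagrangian_action m T eight < (69 / 5 * (m * l ^+ 2 / T))%:E)%E.
Proof.
have X0 : 0 < m * l ^+ 2 / T by rewrite divr_gt0// mulr_gt0// exprn_gt0.
apply: (@le_lt_trans _ _ (eight_level * (m * l ^+ 2 / T))%:E); last first.
  rewrite lte_fin ltr_pM2r// /eight_level.
  have := @pi_lt_16_5 R; have := @pi_gt0 R; nra.
have vE i := path_velocity_unique 0 T (loop_velocity i eight_loop) (eight_path_velocity i).
have vE3 : {ae mu, forall t, t \in `[0, T] ->
    forall i, velocity eight i t = eight_velocity i t}.
  apply: filterS3 (vE 0) (vE 1) (vE (- 1)); first exact: (ae_filter_ringOfSetsType mu).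
  by move=> t e0 e1 e2 tT; elim/ord3_ind; [exact: e0|exact: e1|exact: e2].
have -> : lagrangian_action m T eight =
    (\int[mu]_(t in `[0%R, T]) `|lagrangian m eight t|)%E.
  by apply: eq_integral => t _; rewrite gee0_abs// lagrangian_ge0.
have c0 : 0 <= eight_level * (m * l ^+ 2 / T) / T.
  have level0 : 0 <= eight_level by have := sqr_ge0 (pi : R); rewrite /eight_level; lra.
  by rewrite divr_ge0 ?(ltW T0)// mulr_ge0// ltW.
have mT : mu `[0, T] = T%:E.
  by rewrite lebesgue_measure_itv/= lte_fin T0 -EFinB subr0.
have -> : ((eight_level * (m * l ^+ 2 / T))%:E =
    (eight_level * (m * l ^+ 2 / T) / T)%:E * mu `[0%R, T])%E.
  by rewrite mT -EFinM divfK// gt_eqF.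
apply: integral_le_bound => //.
- by apply: measurable_funTS; exact: lagrangian_measurable eight_loop.
- move: vE3; apply: filterS; first exact: (ae_filter_ringOfSetsType mu).
  move=> t tE tT; rewrite gee0_abs ?lagrangian_ge0//.
  exact/eight_lagrangian/tE.
Qed.

End FigureEight.

(** * Minimizers are collision-free *)

Theorem mainTheorem4 (R : realType) (u : 'rV[R]_2) (m T : R)
    (hu : u != 0) (hm : 0 < m) (hT : 0 < T) :
  (forall x : R -> 'I_3 -> 'rV[R]_2,
     minimizer u m T <[s]>%g x -> forall t : R, collision_free (x t)) /\
  (forall x : R -> 'I_3 -> 'rV[R]_2,
     minimizer u m T <<[set (s ^+ 2)%g; sigma]%SET>>%g x ->
     forall t : R, collision_free (x t)).
Proof.
have [l l_ge0 lT] : exists2 l : R, 0 <= l & l ^+ 3 = m * T ^+ 2.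
  by apply: cube_root; rewrite mulr_ge0 ?sqr_ge0 ?ltW.
have l0 : 0 < l.
  rewrite lt_neqAle l_ge0 andbT; apply/eqP => l_eq0.
  by have := mulr_gt0 hm (exprn_gt0 2 hT); rewrite -lT -l_eq0 expr0n ltxx.
have below G x : minimizer u m T G x ->
    (lagrangian_action m T x < (69 / 5 * (m * l ^+ 2 / T))%:E)%E.
  move=> [_ _ xmin]; apply: le_lt_trans (eight_action hu hm l0 hT lT).
  by apply: xmin; split; [exact: eight_loop|exact: eight_invariant].
split=> x xmin t; apply: contrapT => coll; have := below _ _ xmin;
  rewrite ltNge => /negP; apply; have [xinv _ _] := xmin.
- exact: cyclic_loop_action xinv coll.
- exact: dihedral_loop_action xinv hu coll.
Qed.
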